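(* (i) For any $p\in(1,2)$, $$\tilde C_p=\ell(p,x_p)=\max_{x\in(0,1)}\ell(p,x),$$ where $\ell(p,x):=(1-x)^p-x^p+px^{p-1}$ for $x\in(0,1)$, and $x_p$ is the only root $x\in(0,1)$ of the equation $$(1-x)^{p-1}+x^{p-1}=(p-1)x^{p-2}.$$ Moreover, $\ell(p,x)$ is increasing in $x\in(0,x_p)$ and decreasing in $x\in(x_p,1)$, for each $p\in(1,2)$. (ii) In fact, $x_p\in\big(\frac{p-1}5,\frac{p-1}2\big)\subset(0,\frac12)$ for all $p\in(1,2)$. (iii) Further, $\tilde C_p$ is continuously and strictly decreasing in $p\in(1,2]$ from $\tilde C_{1+}=2$ to $\tilde C_2=1$; furthermore, $\tilde C_p$ is real-analytic in $p\in(1,2)$. (iv) The values $\tilde C_p$ are algebraic for all rational $p\in(1,2]$; in particular, $\tilde C_{3/2}=\sqrt{1+\frac1{\sqrt2}}$ (with $x_{3/2}=\frac14(2-\sqrt2)$). (v) For all $p\in(1,2)$, $$\max\big(\tilde C_p^{-,1},\tilde C_p^{-,2}\big)<\tilde C_p<\min\big(\tilde C_p^{+,1},\tilde C_p^{+,2}\big)\le\tilde C_p^{+,2}<W_p,$$ where \begin{align*} \tilde C_p^{-,1}&:=2^{-p}\big((3-p)^p+(p-1)^{p-1}(p+1)\big),\\ \tilde C_p^{-,2}&:=5^{-p}\big((6-p)^p+(p-1)^{p-1}(4p+1)\big),\\ \tilde C_p^{+,1}&:=\tfrac{2^{-p}}{50(3-p)}\big((p-1)^{p-1}(150+181p-152p^2+21p^3)+(3-p)^{p-1}(450-381p+152p^2-21p^3)\big),\\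 \tilde C_p^{+,2}&:=\tfrac{5^{-p}}{8(6-p)}\big(4(p-1)^{p-1}(12-35p+94p^2-21p^3)+(6-p)^{p-1}(288-15p-94p^2+21p^3)\big),\\ W_p&:=2^{2-p}. \end{align*} The upper bound $W_p$ on $\tilde C_p$ is exact at the endpoints of the interval $(1,2)$ in the sense that $\tilde C_{1+}=W_{1+}$ and $\tilde C_2=\tilde C_{2-}=W_{2-}=W_2$; each of the bounds $\tilde C_p^{-,1}$, $\tilde C_p^{-,2}$, $\tilde C_p^{+,1}$, $\tilde C_p^{+,2}$ is also exact in the similar sense (that is, the same equalities hold with the bound in place of $W$).
   Context: For $p\in(1,2]$, $$\tilde C_p:=C_{|\cdot|^p},\qquad\text{where}\qquad C_f:=\sup_{0<x<s<\infty}\frac{f(x-s)-f(x)+sf'(x)}{f(s)},$$ taken with $f(u)=|u|^p$ for $u\in\mathbb R$. Notation: $F_{1+}$ and $F_{2-}$ denote the right limit at $p=1$ and the left limit at $p=2$ of a function $p\mapsto F_p$. *)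

(* Defs.v *)
From mathcomp Require Import ssralg mxpoly rat Rstruct.
From Stdlib Require Import Reals.
From Coquelicot Require Import Coquelicot.

Open Scope R_scope.

(* u |-> |u|^p for p > 0.  The case u = 0 is separate because Rpower 0 p is
   exp (p * ln 0) = 1 with the total ln of the standard library. *)
Definition abs_pow (p u : R) : R :=
  if Req_EM_T u 0 then 0 else Rpower (Rabs u) p.

Definition C_ (f : R -> R) : Rbar :=
  Lub_Rbar (fun v : R => exists x s : R, 0 < x < s /\
    v = (f (x - s) - f x + s * Derive f x) / f s).

(* [real] sends infinite values to 0, so this is meaningful only together with
   the finiteness of C_ (abs_pow p). *)
Definition Ctilde (p : R) : R := real (C_ (abs_pow p)).

Definition ell (p x : R) : R :=
  Rpower (1 - x) p - Rpower x p + p * Rpower x (p - 1).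

Definition root_eq (p x : R) : Prop :=
  0 < x < 1 /\
  Rpower (1 - x) (p - 1) + Rpower x (p - 1) = (p - 1) * Rpower x (p - 2).

Definition Cm1 (p : R) : R :=
  Rpower 2 (- p) *
  (Rpower (3 - p) p + Rpower (p - 1) (p - 1) * (p + 1)).

Definition Cm2 (p : R) : R :=
  Rpower 5 (- p) *
  (Rpower (6 - p) p + Rpower (p - 1) (p - 1) * (4 * p + 1)).

Definition Cp1 (p : R) : R :=
  Rpower 2 (- p) / (50 * (3 - p)) *
  (Rpower (p - 1) (p - 1) * (150 + 181 * p - 152 * p ^ 2 + 21 * p ^ 3) +
   Rpower (3 - p) (p - 1) * (450 - 381 * p + 152 * p ^ 2 - 21 * p ^ 3)).

Definition Cp2 (p : R) : R :=
  Rpower 5 (- p) / (8 * (6 - p)) *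
  (4 * Rpower (p - 1) (p - 1) * (12 - 35 * p + 94 * p ^ 2 - 21 * p ^ 3) +
   Rpower (6 - p) (p - 1) * (288 - 15 * p - 94 * p ^ 2 + 21 * p ^ 3)).

Definition W (p : R) : R := Rpower 2 (2 - p).

Definition right_lim (F : R -> R) (a l : R) : Prop :=
  filterlim F (at_right a) (locally l).

Definition left_lim (F : R -> R) (a l : R) : Prop :=
  filterlim F (at_left a) (locally l).

(* C_{1+} = B_{1+} and C_2 = C_{2-} = B_{2-} = B_2, existence of the one-sided
   limits included. *)
Definition exact_at_endpoints (B : R -> R) : Prop :=
  (exists l : R, right_lim Ctilde 1 l /\ right_lim B 1 l) /\
  (left_lim Ctilde 2 (Ctilde 2) /\ left_lim B 2 (Ctilde 2) /\
   B 2 = Ctilde 2).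

Definition real_analytic_at (F : R -> R) (p0 : R) : Prop :=
  exists a : nat -> R, locally p0 (fun p => is_pseries a (p - p0) (F p)).

Definition rational (x : R) : Prop :=
  exists q : rat, x = ratr q.

(* Algebraic over the rationals, R being a field through Rstruct. *)
Definition algebraic (x : R) : Prop :=
  algebraicOver (ratr : rat -> R) x.

(* Main.v *)
Require Import Defs.
From mathcomp Require ssreflect ssrfun ssrbool eqtype ssrnat seq.
From mathcomp Require order ssralg ssrnum ssrint poly mxpoly rat Rstruct.
From Stdlib Require Import Reals Lra Lia List Factorial.
From Coquelicot Require Import Coquelicot.

Open Scope R_scope.

(** Dividing numerator and denominator of the quotient that defines C_f by
    s ^ p turns it into [ell p (x / s)], so Ctilde p is the supremum of
    [ell p] over (0, 1).  The derivative of ell is p (1 - x) times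

      weighted_slope p x =
        (p - 1 - x) x ^ (p - 2) / (1 - x) - (1 - x) ^ (p - 2),

    which strictly decreases on (0, p - 1) because each of its factors is
    monotone, while the derivative is negative beyond p - 1.  Hence the
    derivative changes sign exactly once, from plus to minus, and testing its
    sign at (p - 1) / 5, (p - 1) / 2 and 1 / 4 locates the zero, [argmax p].
    At the zero the value of ell simplifies to
    (p - 1) (argmax p) ^ (p - 2) ([Ctilde_argmax]).

    Monotonicity in p: for a fixed x <= 1/4 the function p |-> ell p x
    decreases, and argmax q < 1/4, so
    Ctilde q = ell q (argmax q) < ell p (argmax q) <= Ctilde p for p < q < 2;
    ell 2 is constant, so that for q = 2 any x <= 1/4 can replace argmax q.

    Analyticity: by the implicit function theorem argmax is differentiable, and
    its derivative is a polynomial in p, 1 / (p - 1), 1 / (2 - p), argmax,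
    ln argmax and ln (1 - argmax).  The derivatives of these functions and of
    Ctilde are polynomials in the family enlarged by Ctilde.  Functions that
    solve such a polynomial differential system are analytic
    ([polynomial_ode_analytic]): by the product rule their n-th derivatives are
    polynomials whose degree grows linearly in n and whose coefficients sum to
    at most K ^ n n!, so these derivatives satisfy the bounds that make the
    Taylor series converge to the function.

    Algebraicity: if p - 1 = m / n, the n-th power of the equation for
    x = argmax p is (p - 1 - x) ^ n = (1 - x) ^ m x ^ (n - m), a polynomial
    equation over the rationals, and Ctilde p ^ n is a rational function of x.

    Bounds: the lower bounds are values of ell at (p - 1) / 2 and (p - 1) / 5,
    which are not the maximizer.  Since weighted_slope decreases, ell is
    strictly concave as a function of (1 - x) ^ 2 for x < p - 1; the upper bounds are the
    tangents of ell in that variable at one of these two points, evaluated at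
    the other one ([ell_lt_tangent_bound]).  The comparison of the second upper
    bound with 2 ^ (2 - p), an equality at both ends p = 1 and p = 2, follows
    by replacing the powers with rational bounds that keep these equalities
    ([Cp2_W_inequality]).  Finally all bounds tend to 2 at p = 1 and to 1 at
    p = 2, which by squeezing gives the limits of Ctilde. *)

(** * Calculus and elementary inequalities *)

Lemma le_of_derive_ge0 (f df : R -> R) a b :
  a <= b -> (forall x, a <= x <= b -> is_derive f x (df x)) ->
  (forall x, a <= x <= b -> 0 <= df x) -> f a <= f b.
Proof.
intros Hab Hd Hs.
destruct (MVT_gen f a b df) as [c [Hc Heq]].
- intros x; rewrite Rmin_left, Rmax_right by trivial; intros Hx; apply Hd; lra.
- intros x; rewrite Rmin_left, Rmax_right by trivial; intros Hx.
  apply continuity_pt_filterlim, @ex_derive_continuous; eexists; now apply Hd.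
- rewrite Rmin_left, Rmax_right in Hc by trivial.
  assert (0 <= df c * (b - a)) by (apply Rmult_le_pos; [now apply Hs | lra]).
  lra.
Qed.

Lemma lt_of_derive_gt0 (f df : R -> R) a b :
  a < b -> (forall x, a <= x <= b -> is_derive f x (df x)) ->
  (forall x, a < x < b -> 0 < df x) -> f a < f b.
Proof.
intros Hab Hd Hs.
destruct (MVT_cor2 f df a b Hab) as [c [Heq Hc]].
- intros x Hx; apply is_derive_Reals; now apply Hd.
- assert (0 < df c * (b - a)) by (apply Rmult_lt_0_compat; [now apply Hs | lra]).
  lra.
Qed.

Lemma lt_of_derive_lt0 (f df : R -> R) a b :
  a < b -> (forall x, a <= x <= b -> is_derive f x (df x)) ->
  (forall x, a < x < b -> df x < 0) -> f b < f a.
Proof.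
intros Hab Hd Hs.
enough (- f a < - f b) by lra.
apply lt_of_derive_gt0 with (f := fun x => - f x) (df := fun x => - df x); trivial.
- intros x Hx; apply @is_derive_opp; now apply Hd.
- intros x Hx; specialize (Hs x Hx); lra.
Qed.

(** The difference of the two sides vanishes at 1 and has derivative
    (y - 1)^2 / (y (y + 1)^2).  This Pade bound is sharp enough for every
    numerical value of ln below, and uniformly for ln (1 / a) in the
    comparison with W. *)
Lemma ln_ge_pade y : 1 <= y -> 2 * (y - 1) / (y + 1) <= ln y.
Proof.
intros Hy.
enough (ln 1 - 2 * (1 - 1) / (1 + 1) <= ln y - 2 * (y - 1) / (y + 1)).
{ rewrite ln_1 in H; lra. }
apply le_of_derive_ge0 with (f := fun x => ln x - 2 * (x - 1) / (x + 1))
  (df := fun x => (x - 1) ^ 2 / (x * (x + 1) ^ 2)); trivial.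
- intros x Hx; auto_derive; [lra | field; lra].
- intros x Hx; apply Rmult_le_pos; [apply pow2_ge_0 |].
  apply Rlt_le, Rinv_0_lt_compat, Rmult_lt_0_compat; [lra | apply pow_lt; lra].
Qed.

Lemma ln_le_pade y : 1 <= y -> ln y <= (y ^ 2 - 1) / (2 * y).
Proof.
intros Hy.
enough ((1 ^ 2 - 1) / (2 * 1) - ln 1 <= (y ^ 2 - 1) / (2 * y) - ln y).
{ rewrite ln_1 in H; lra. }
apply le_of_derive_ge0 with (f := fun x => (x ^ 2 - 1) / (2 * x) - ln x)
  (df := fun x => (x - 1) ^ 2 / (2 * x ^ 2)); trivial.
- intros x Hx; auto_derive; [lra | field; lra].
- intros x Hx; apply Rmult_le_pos; [apply pow2_ge_0 |].
  apply Rlt_le, Rinv_0_lt_compat, Rmult_lt_0_compat; [lra | apply pow_lt; lra].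
Qed.

(** Splitting 2 = (3/2)(4/3) makes the upper Pade bound, which is poor at
    2, good enough. *)
Lemma ln_2_bounds : 2 / 3 <= ln 2 <= 17 / 24.
Proof.
split.
- pose proof (ln_ge_pade 2); lra.
- replace 2 with (3 / 2 * (4 / 3)) by field.
  rewrite ln_mult by lra.
  pose proof (ln_le_pade (3 / 2)); pose proof (ln_le_pade (4 / 3)); lra.
Qed.

Lemma ln_3_lt : ln 3 < 4 / 3.
Proof.
replace 3 with (2 * (3 / 2)) by field; rewrite ln_mult by lra.
pose proof ln_2_bounds; pose proof (ln_le_pade (3 / 2)); lra.
Qed.

Lemma ln_4_gt : 5 / 4 < ln 4.
Proof.
replace 4 with (2 * 2) by ring; rewrite ln_mult by lra.
pose proof ln_2_bounds; lra.
Qed.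

Lemma ln_5_2_bounds : 8 / 9 <= ln (5 / 2) <= 14 / 15.
Proof.
replace (5 / 2) with (2 * (5 / 4)) by field; rewrite ln_mult by lra.
pose proof ln_2_bounds; pose proof (ln_le_pade (5 / 4)).
pose proof (ln_ge_pade (5 / 4)); lra.
Qed.

Lemma exp_le_exp x y : x <= y -> exp x <= exp y.
Proof. intros [H | ->]; [now apply Rlt_le, exp_increasing | lra]. Qed.

(** Odd Taylor polynomials of exp are below exp on the whole line: the
    derivative of the difference is the quadratic remainder, which increases
    and hence has the sign of x. *)
Lemma exp_ge_cubic x : 1 + x + x ^ 2 / 2 + x ^ 3 / 6 <= exp x.
Proof.
assert (Hq : forall u v, u <= v ->
  exp u - (1 + u + u ^ 2 / 2) <= exp v - (1 + v + v ^ 2 / 2)).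
{ intros u v Huv.
  apply le_of_derive_ge0 with (f := fun x => exp x - (1 + x + x ^ 2 / 2))
    (df := fun x => exp x - (1 + x)); trivial.
  - intros y _; auto_derive; trivial; field.
  - intros y _; pose proof (exp_ineq1_le y); lra. }
pose proof exp_0 as H0.
destruct (Rle_lt_dec 0 x) as [Hx | Hx].
- enough (exp 0 - (1 + 0 + 0 ^ 2 / 2 + 0 ^ 3 / 6)
      <= exp x - (1 + x + x ^ 2 / 2 + x ^ 3 / 6)) by lra.
  apply le_of_derive_ge0 with (f := fun x => exp x - (1 + x + x ^ 2 / 2 + x ^ 3 / 6))
    (df := fun x => exp x - (1 + x + x ^ 2 / 2)); trivial.
  + intros y _; auto_derive; trivial; field.
  + intros y Hy; specialize (Hq 0 y (proj1 Hy)); lra.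
- enough (1 + x + x ^ 2 / 2 + x ^ 3 / 6 - exp x
     <= (1 + 0 + 0 ^ 2 / 2 + 0 ^ 3 / 6) - exp 0) by lra.
  apply le_of_derive_ge0 with (f := fun x => (1 + x + x ^ 2 / 2 + x ^ 3 / 6) - exp x)
    (df := fun x => (1 + x + x ^ 2 / 2) - exp x); try lra.
  + intros y _; auto_derive; trivial; field.
  + intros y Hy; specialize (Hq y 0 (proj2 Hy)); lra.
Qed.

Lemma Rpower_gt0 x q : 0 < Rpower x q.
Proof. apply exp_pos. Qed.

Lemma Rpower_pred x q : 0 < x -> Rpower x (q - 1) = Rpower x q / x.
Proof.
intros Hx; unfold Rminus; rewrite Rpower_plus, Rpower_Ropp, Rpower_1; trivial.
Qed.

Lemma Rpower_pred2 x p : 0 < x -> Rpower x (p - 2) = Rpower x (p - 1) / x.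
Proof.
intros Hx; replace (p - 2) with (p - 1 - 1) by ring; now apply Rpower_pred.
Qed.

Lemma Rpower_div x y q : 0 < x -> 0 < y -> Rpower (x / y) q = Rpower x q / Rpower y q.
Proof.
intros Hx Hy; unfold Rdiv at 1; rewrite <- Rpower_mult_distr; trivial.
2: now apply Rinv_0_lt_compat.
replace (Rpower (/ y) q) with (/ Rpower y q); trivial.
rewrite <- Rpower_Ropp; unfold Rpower; rewrite ln_Rinv by trivial; f_equal; ring.
Qed.

Lemma Rpower_lt_neg x y q : q < 0 -> 0 < x < y -> Rpower y q < Rpower x q.
Proof.
intros Hq Hxy; apply exp_increasing.
assert (ln x < ln y) by (apply ln_increasing; lra); nra.
Qed.

(** Weighted AM-GM for y and 1: average the bounds 1 + t <= exp t for
    y^(1-a) and y^(-a) with weights a and 1 - a; the logarithms cancel. *)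
Lemma Rpower_le_bernoulli y a : 0 < y -> 0 <= a <= 1 -> Rpower y a <= 1 + a * (y - 1).
Proof.
intros Hy Ha.
assert (H1 : 1 + (1 - a) * ln y <= Rpower y (1 - a)) by apply exp_ineq1_le.
assert (H2 : 1 + - a * ln y <= Rpower y (- a)) by apply exp_ineq1_le.
assert (E1 : Rpower y (1 - a) = y / Rpower y a).
{ unfold Rminus; rewrite Rpower_plus, Rpower_Ropp, Rpower_1; trivial. }
rewrite E1 in H1; rewrite Rpower_Ropp in H2.
pose proof (Rpower_gt0 y a) as Hp.
assert (1 <= (a * y + (1 - a)) / Rpower y a).
{ unfold Rdiv in *; nra. }
apply Rmult_le_compat_r with (r := Rpower y a) in H; [| lra].
replace ((a * y + (1 - a)) / Rpower y a * Rpower y a) with (a * y + (1 - a)) in H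
  by (field; lra).
lra.
Qed.

Lemma is_derive_Rpower x q :
  0 < x -> is_derive (fun x => Rpower x q) x (q * Rpower x (q - 1)).
Proof. intros Hx; now apply is_derive_Reals, derivable_pt_lim_power. Qed.

(** * The derivative of ell and its zero *)

(** The derivative of [ell p] divided by p. *)
Definition slope (p x : R) : R :=
  (p - 1) * Rpower x (p - 2) - Rpower (1 - x) (p - 1) - Rpower x (p - 1).

Lemma is_derive_ell p x : 0 < x < 1 -> is_derive (ell p) x (p * slope p x).
Proof.
intros Hx; unfold ell, slope.
replace (p * _) with (-1 * (p * Rpower (1 - x) (p - 1)) - p * Rpower x (p - 1)
  + p * ((p - 1) * Rpower x (p - 1 - 1))).
2:{ replace (p - 1 - 1) with (p - 2) by ring; ring. }
apply @is_derive_plus; [apply @is_derive_minus |].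
- apply (is_derive_comp (fun y => Rpower y p) (fun y => 1 - y)).
  + apply is_derive_Rpower; lra.
  + auto_derive; trivial; ring.
- apply is_derive_Rpower; lra.
- apply is_derive_scal, is_derive_Rpower; lra.
Qed.

(** Up to the factor - p / 2, the derivative of [ell p] with respect to
    the variable (1 - x)^2.  Unlike slope, it is visibly monotone. *)
Definition weighted_slope (p x : R) : R :=
  (p - 1 - x) / (1 - x) * Rpower x (p - 2) - Rpower (1 - x) (p - 2).

Lemma slope_factor p x : 0 < x < 1 ->
  slope p x = (p - 1 - x) * Rpower x (p - 2) - Rpower (1 - x) (p - 1).
Proof.
intros Hx; unfold slope.
rewrite (Rpower_pred2 x) by lra.
field; lra.
Qed.

Lemma slope_eq_weighted p x : 0 < x < 1 -> slope p x = (1 - x) * weighted_slope p x.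
Proof.
intros Hx; rewrite slope_factor by trivial; unfold weighted_slope.
rewrite (Rpower_pred2 (1 - x)) by lra.
field; lra.
Qed.

(** (p - 1 - x) / (1 - x) = 1 - (2 - p) / (1 - x) is nonnegative and
    decreasing up to p - 1, x^(p-2) is decreasing and (1 - x)^(p-2) is
    increasing. *)
Lemma weighted_slope_decreasing p x y : 1 < p < 2 -> 0 < x < y -> y <= p - 1 ->
  weighted_slope p y < weighted_slope p x.
Proof.
intros Hp Hx Hy; unfold weighted_slope.
assert (H1 : Rpower y (p - 2) < Rpower x (p - 2)) by (apply Rpower_lt_neg; lra).
assert (H2 : Rpower (1 - x) (p - 2) < Rpower (1 - y) (p - 2))
  by (apply Rpower_lt_neg; lra).
assert (H3 : (p - 1 - y) / (1 - y) < (p - 1 - x) / (1 - x)).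
{ apply Rlt_0_minus.
  replace (_ - _) with ((2 - p) * (y - x) * / ((1 - x) * (1 - y))) by (field; lra).
  apply Rmult_lt_0_compat; [nra | apply Rinv_0_lt_compat; nra]. }
assert (H4 : 0 <= (p - 1 - y) / (1 - y)).
{ apply Rmult_le_pos; [lra | apply Rlt_le, Rinv_0_lt_compat; lra]. }
pose proof (Rpower_gt0 y (p - 2)); nra.
Qed.

Lemma slope_lt0_right p x : 1 < p < 2 -> p - 1 <= x < 1 -> slope p x < 0.
Proof.
intros Hp Hx; rewrite slope_factor by lra.
pose proof (Rpower_gt0 x (p - 2)); pose proof (Rpower_gt0 (1 - x) (p - 1)); nra.
Qed.

(** At x = (p - 1) / 2 the slope collapses to
    x^(p-1) - (1 - x)^(p-1), and x < 1/2. *)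
Lemma slope_half p : 1 < p < 2 -> slope p ((p - 1) / 2) < 0.
Proof.
intros Hp; rewrite slope_factor by lra.
rewrite Rpower_pred2 by lra.
replace ((p - 1 - (p - 1) / 2) * (Rpower ((p - 1) / 2) (p - 1) / ((p - 1) / 2)))
  with (Rpower ((p - 1) / 2) (p - 1)) by (field; lra).
assert (Rpower ((p - 1) / 2) (p - 1) < Rpower (1 - (p - 1) / 2) (p - 1))
  by (apply Rlt_Rpower_l; lra).
lra.
Qed.

(** After division by ((p - 1) / 5)^(p-1) the claim reads
    ((6 - p) / (p - 1))^(p-1) < 4, with equality at p = 2; the tangent of ln
    at 4 reduces it to 5/4 < ln 4. *)
Lemma slope_fifth p : 1 < p < 2 -> 0 < slope p ((p - 1) / 5).
Proof.
intros Hp; rewrite slope_factor by lra.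
rewrite Rpower_pred2 by lra.
replace ((p - 1 - (p - 1) / 5) * (Rpower ((p - 1) / 5) (p - 1) / ((p - 1) / 5)))
  with (4 * Rpower ((p - 1) / 5) (p - 1)) by (field; lra).
replace (1 - (p - 1) / 5) with ((p - 1) / 5 * ((6 - p) / (p - 1))) by (field; lra).
assert (Hu : 0 < (6 - p) / (p - 1)) by (apply Rdiv_lt_0_compat; lra).
rewrite <- Rpower_mult_distr by lra.
enough (Rpower ((6 - p) / (p - 1)) (p - 1) < 4).
{ pose proof (Rpower_gt0 ((p - 1) / 5) (p - 1)); nra. }
rewrite <- (exp_ln 4) by lra; apply exp_increasing.
pose proof ln_4_gt.
(* The logarithm lies below its tangent at 4, the value of the ratio at p = 2. *)
assert (Hl : ln ((6 - p) / (p - 1)) <= ln 4 + ((6 - p) / (p - 1) / 4 - 1)).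
{ replace ((6 - p) / (p - 1)) with (4 * ((6 - p) / (p - 1) / 4)) at 1 by (field; lra).
  rewrite ln_mult by lra.
  pose proof (exp_ineq1_le (ln ((6 - p) / (p - 1) / 4))).
  rewrite exp_ln in H0 by lra; lra. }
apply Rmult_le_compat_l with (r := p - 1) in Hl; [| lra].
replace ((p - 1) * (ln 4 + ((6 - p) / (p - 1) / 4 - 1)))
  with ((p - 1) * ln 4 + 5 / 4 * (2 - p)) in Hl by (field; lra).
nra.
Qed.

(** After division by (1/4)^(p-1) the claim reads
    4 (p - 1) - 1 < 3^(p-1), with equality at p = 2. *)
Lemma slope_quarter p : 1 < p < 2 -> slope p (1 / 4) < 0.
Proof.
intros Hp; rewrite slope_factor by lra.
rewrite Rpower_pred2 by lra.
replace (1 - 1 / 4) with (1 / 4 * 3) by field.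
rewrite <- Rpower_mult_distr by lra.
enough (4 * (p - 1) - 1 < Rpower 3 (p - 1)).
{ pose proof (Rpower_gt0 (1 / 4) (p - 1)).
  replace ((p - 1 - 1 / 4) * (Rpower (1 / 4) (p - 1) / (1 / 4)))
    with ((4 * (p - 1) - 1) * Rpower (1 / 4) (p - 1)) by field.
  nra. }
(* The two sides agree at p = 2, where the tangent of 3 ^ (p - 1) has slope
   3 ln 3 < 4. *)
replace (Rpower 3 (p - 1)) with (3 * Rpower 3 (p - 2)).
2:{ rewrite <- (Rpower_1 3) at 1 by lra; rewrite <- Rpower_plus; f_equal; ring. }
assert (1 + (p - 2) * ln 3 <= Rpower 3 (p - 2)) by apply exp_ineq1_le.
pose proof ln_3_lt; nra.
Qed.

(** A zero of the slope together with the sign pattern that makes it the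
    unique maximizer of [ell p]. *)
Definition critical (p x : R) : Prop :=
  0 < x < 1 /\ slope p x = 0 /\
  (forall y, 0 < y < x -> 0 < slope p y) /\ (forall y, x < y < 1 -> slope p y < 0).

Lemma critical_intro p x : 1 < p < 2 -> 0 < x < 1 -> slope p x = 0 -> critical p x.
Proof.
intros Hp Hx Hs.
assert (Hxp : x < p - 1).
{ destruct (Rlt_le_dec x (p - 1)) as [H | H]; trivial.
  pose proof (slope_lt0_right p x Hp); lra. }
assert (Hw : weighted_slope p x = 0).
{ rewrite slope_eq_weighted in Hs by trivial.
  apply Rmult_integral in Hs; destruct Hs; trivial; lra. }
repeat split; try apply Hx; trivial.
- intros y Hy; rewrite slope_eq_weighted by lra.
  pose proof (weighted_slope_decreasing p y x Hp Hy); apply Rmult_lt_0_compat; lra.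
- intros y Hy.
  destruct (Rlt_le_dec y (p - 1)) as [H | H].
  + rewrite slope_eq_weighted by lra.
    assert (weighted_slope p y < weighted_slope p x) by (apply weighted_slope_decreasing; lra).
    nra.
  + apply slope_lt0_right; lra.
Qed.

Lemma critical_exists p : 1 < p < 2 -> exists x, critical p x.
Proof.
intros Hp.
destruct (Ranalysis5.IVT_interv (fun x => - slope p x) ((p - 1) / 5) ((p - 1) / 2))
  as [x [Hx Hs]].
- intros x Hx; apply continuity_pt_filterlim.
  apply (ex_derive_continuous (fun x => - slope p x)).
  unfold slope, Rpower; auto_derive; lra.
- lra.
- pose proof (slope_fifth p Hp); lra.
- pose proof (slope_half p Hp); lra.
- exists x; apply critical_intro; lra.
Qed.

Lemma critical_lt p x y : critical p x -> 0 < y < 1 -> slope p y < 0 -> x < y.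
Proof.
intros [Hx [H0 [Hl _]]] Hy Hs.
destruct (Rtotal_order x y) as [H | [H | H]]; trivial.
- subst; lra.
- specialize (Hl y); lra.
Qed.

Lemma critical_gt p x y : critical p x -> 0 < y < 1 -> 0 < slope p y -> y < x.
Proof.
intros [Hx [H0 [_ Hr]]] Hy Hs.
destruct (Rtotal_order x y) as [H | [H | H]]; trivial.
- specialize (Hr y); lra.
- subst; lra.
Qed.

Lemma critical_unique p x y : critical p x -> 0 < y < 1 -> slope p y = 0 -> x = y.
Proof.
intros [Hx [H0 [Hl Hr]]] Hy Hs.
destruct (Rtotal_order x y) as [H | [H | H]]; trivial.
- specialize (Hr y); lra.
- specialize (Hl y); lra.
Qed.

(** The right end of the interval on which [ell p] increases; as a
    supremum it is an explicit function of p. *)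
Definition argmax (p : R) : R :=
  real (Lub_Rbar (fun x => 0 < x < 1 /\ 0 < slope p x)).

Lemma argmax_critical p : 1 < p < 2 -> critical p (argmax p).
Proof.
intros Hp; destruct (critical_exists p Hp) as [x Hx].
replace (argmax p) with x; trivial.
unfold argmax; rewrite (is_lub_Rbar_unique _ (Finite x)); trivial.
split.
- intros y [Hy Hs]; simpl; apply Rlt_le; now apply (critical_gt p).
- intros b Hb; destruct Hx as [Hx [_ [Hl _]]].
  assert (Hy : forall y, 0 < y < x -> Rbar_le y b).
  { intros y Hy; apply Hb; split; [lra | now apply Hl]. }
  destruct b as [b | |]; simpl; trivial.
  + destruct (Rle_lt_dec x b) as [H | H]; trivial.
    assert (H1 := Hy ((Rmax b 0 + x) / 2)); simpl in H1.
    pose proof (Rmax_l b 0); pose proof (Rmax_r b 0).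
    assert (Rmax b 0 < x) by (apply Rmax_lub_lt; lra).
    lra.
  + apply (Hy (x / 2)); lra.
Qed.

Lemma argmax_bounds p : 1 < p < 2 -> (p - 1) / 5 < argmax p < (p - 1) / 2.
Proof.
intros Hp; pose proof (argmax_critical p Hp) as Hc; split.
- apply (critical_gt p); trivial; [lra | now apply slope_fifth].
- apply (critical_lt p); trivial; [lra | now apply slope_half].
Qed.

Lemma argmax_lt_quarter p : 1 < p < 2 -> argmax p < 1 / 4.
Proof.
intros Hp; apply (critical_lt p); [now apply argmax_critical | lra | now apply slope_quarter].
Qed.

Lemma argmax_01 p : 1 < p < 2 -> 0 < argmax p < 1.
Proof. intros Hp; apply (argmax_critical p Hp). Qed.

Lemma root_eq_slope p x : root_eq p x <-> 0 < x < 1 /\ slope p x = 0.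
Proof.
unfold root_eq, slope; split; intros [Hx H]; split; trivial; lra.
Qed.

Lemma ell_increasing p x y : 1 < p < 2 -> 0 < x -> x < y -> y <= argmax p ->
  ell p x < ell p y.
Proof.
intros Hp Hx Hxy Hy; pose proof (argmax_critical p Hp) as [H1 [H2 [H3 _]]].
apply lt_of_derive_gt0 with (df := fun x => p * slope p x); trivial.
- intros z Hz; apply is_derive_ell; lra.
- intros z Hz; apply Rmult_lt_0_compat; [lra | apply H3; lra].
Qed.

Lemma ell_decreasing p x y : 1 < p < 2 -> argmax p <= x -> x < y -> y < 1 ->
  ell p y < ell p x.
Proof.
intros Hp Hx Hxy Hy; pose proof (argmax_critical p Hp) as [H1 [H2 [_ H3]]].
apply lt_of_derive_lt0 with (df := fun x => p * slope p x); trivial.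
- intros z Hz; apply is_derive_ell; lra.
- intros z Hz; specialize (H3 z); nra.
Qed.

Lemma ell_lt_max p x : 1 < p < 2 -> 0 < x < 1 -> x <> argmax p ->
  ell p x < ell p (argmax p).
Proof.
intros Hp Hx Hne.
destruct (Rtotal_order x (argmax p)) as [H | [H | H]]; [| easy |].
- apply ell_increasing; lra.
- apply ell_decreasing; lra.
Qed.

Lemma ell_le_max p x : 1 < p < 2 -> 0 < x < 1 -> ell p x <= ell p (argmax p).
Proof.
intros Hp Hx; destruct (Req_dec x (argmax p)) as [-> | H]; [lra |].
now apply Rlt_le, ell_lt_max.
Qed.

(** * The supremum is a maximum of ell *)

(** Homogeneity: divide by s^p. *)
Lemma C_ratio p x s : 0 < x < s ->
  (abs_pow p (x - s) - abs_pow p x + s * Derive (abs_pow p) x) / abs_pow p s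
  = ell p (x / s).
Proof.
intros Hx.
assert (Hpos : forall u, 0 < u -> abs_pow p u = Rpower u p).
{ intros u Hu; unfold abs_pow; destruct (Req_EM_T u 0); [lra |].
  rewrite Rabs_pos_eq; trivial; lra. }
replace (abs_pow p (x - s)) with (Rpower (s - x) p).
2:{ unfold abs_pow; destruct (Req_EM_T (x - s) 0); [lra |].
    rewrite Rabs_minus_sym, Rabs_pos_eq; trivial; lra. }
rewrite !Hpos by lra.
replace (Derive (abs_pow p) x) with (p * Rpower x (p - 1)).
2:{ symmetry; apply is_derive_unique.
    apply is_derive_ext_loc with (f := fun x => Rpower x p).
    - apply (locally_interval _ x 0 p_infty); simpl; trivial; try lra.
      intros y Hy _; symmetry; now apply Hpos.
    - apply is_derive_Rpower; lra. }
unfold ell.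
replace (1 - x / s) with ((s - x) / s) by (field; lra).
rewrite !Rpower_div by lra.
rewrite (Rpower_pred s) by lra.
pose proof (Rpower_gt0 s p); field; lra.
Qed.

(** The pair (x0, 1) attains the supremum, so it is enough that no other
    value of ell is larger. *)
Lemma C_abs_pow p x0 : 0 < x0 < 1 -> (forall t, 0 < t < 1 -> ell p t <= ell p x0) ->
  C_ (abs_pow p) = Finite (ell p x0).
Proof.
intros Hx0 Hmax; apply is_lub_Rbar_unique; split.
- intros v [x [s [Hx ->]]]; rewrite C_ratio by trivial; apply Hmax.
  split; [apply Rdiv_lt_0_compat; lra |].
  apply Rmult_lt_reg_r with s; [lra |].
  unfold Rdiv; rewrite Rmult_assoc, Rinv_l; lra.
- intros b Hb; apply (Hb (ell p x0)).
  exists x0, 1; split; trivial.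
  rewrite C_ratio by trivial; f_equal; field.
Qed.

Lemma ell_2 x : 0 < x < 1 -> ell 2 x = 1.
Proof.
intros Hx; unfold ell.
replace (2 - 1) with 1 by ring; rewrite Rpower_1 by lra.
replace 2 with (INR 2) at 1 2 by (simpl; ring).
rewrite !Rpower_pow by lra; ring.
Qed.

Lemma C_abs_pow_lt2 p : 1 < p < 2 -> C_ (abs_pow p) = Finite (ell p (argmax p)).
Proof.
intros Hp; apply C_abs_pow; [now apply argmax_01 |].
intros t; now apply ell_le_max.
Qed.

Lemma C_abs_pow_2 : C_ (abs_pow 2) = Finite 1.
Proof.
rewrite (C_abs_pow 2 (1 / 2)); [rewrite ell_2; trivial; lra | lra |].
intros t Ht; rewrite !ell_2; lra.
Qed.

Lemma Ctilde_ell p : 1 < p < 2 -> Ctilde p = ell p (argmax p).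
Proof. intros Hp; unfold Ctilde; now rewrite C_abs_pow_lt2. Qed.

Lemma Ctilde_2 : Ctilde 2 = 1.
Proof. unfold Ctilde; now rewrite C_abs_pow_2. Qed.

Lemma argmax_eq p : 1 < p < 2 ->
  (p - 1 - argmax p) * Rpower (argmax p) (p - 2) = Rpower (1 - argmax p) (p - 1).
Proof.
intros Hp; pose proof (argmax_critical p Hp) as [H1 [H2 _]].
rewrite slope_factor in H2 by trivial; lra.
Qed.

(** The equation [argmax_eq] eliminates (1 - x)^p from ell, and the terms
    in x^(p-1) cancel. *)
Lemma Ctilde_argmax p : 1 < p < 2 -> Ctilde p = (p - 1) * Rpower (argmax p) (p - 2).
Proof.
intros Hp; rewrite Ctilde_ell by trivial.
pose proof (argmax_eq p Hp) as H; pose proof (argmax_01 p Hp) as Hx; revert H Hx.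
generalize (argmax p); intros x H Hx; unfold ell.
assert (H1 : Rpower (1 - x) p = (1 - x) * Rpower (1 - x) (p - 1)).
{ rewrite Rpower_pred by lra; field; lra. }
assert (H2 : Rpower x (p - 1) = x * Rpower x (p - 2)).
{ rewrite Rpower_pred2 by lra; field; lra. }
assert (H3 : Rpower x p = x * Rpower x (p - 1)).
{ rewrite Rpower_pred by lra; field; lra. }
rewrite H3, H1, <- H, H2; ring.
Qed.

(** * Monotonicity in the exponent *)

(** Since (1 - x)^(r-1) >= x^(r-1) and both logarithms are negative, the
    derivative in r is at most
    x^(r-1) (1 + (1 - x) ln (x (1 - x))), and for x <= 1/4 the last term is
    below (3/4) ln (3/16) < -1. *)
Lemma ell_decreasing_exponent p q x : 1 < p < q -> 0 < x <= 1 / 4 ->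
  ell q x < ell p x.
Proof.
intros Hp Hx.
apply lt_of_derive_lt0 with (f := fun r => ell r x) (df := fun r =>
   Rpower (1 - x) r * ln (1 - x) - Rpower x r * ln x
   + (Rpower x (r - 1) + r * (Rpower x (r - 1) * ln x))); [lra | |].
- intros r _; unfold ell, Rpower; auto_derive; trivial; unfold Rminus; ring.
- intros r Hr.
  replace (Rpower (1 - x) r) with ((1 - x) * Rpower (1 - x) (r - 1))
    by (rewrite Rpower_pred by lra; field; lra).
  replace (Rpower x r) with (x * Rpower x (r - 1))
    by (rewrite Rpower_pred by lra; field; lra).
  assert (Hxx : Rpower x (r - 1) <= Rpower (1 - x) (r - 1))
    by (apply Rle_Rpower_l; lra).
  pose proof (Rpower_gt0 x (r - 1)) as H0.
  assert (Hl : ln x + ln (1 - x) < - (4 / 3)).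
  { rewrite <- ln_mult by lra.
    apply Rle_lt_trans with (ln (3 / 16)); [apply ln_le; nra |].
    replace (3 / 16) with (/ (2 * 2 * (4 / 3))) by field.
    rewrite ln_Rinv, !ln_mult by lra.
    pose proof ln_2_bounds; pose proof (ln_ge_pade (4 / 3)); lra. }
  assert (L1 : ln (1 - x) < 0) by (rewrite <- ln_1; apply ln_increasing; lra).
  assert (L0 : ln x < 0) by (rewrite <- ln_1; apply ln_increasing; lra).
  apply Rle_lt_trans with (Rpower x (r - 1) *
    ((1 - x) * ln (1 - x) - x * ln x + 1 + 1 * ln x)); [| ].
  + assert (0 <= (1 - x) * - ln (1 - x) * (Rpower (1 - x) (r - 1) - Rpower x (r - 1)))
      by (repeat apply Rmult_le_pos; lra).
    assert ((r - 1) * (Rpower x (r - 1) * - ln x) >= 0).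
    { apply Rle_ge, Rmult_le_pos; [lra |]; apply Rmult_le_pos; lra. }
    lra.
  + assert ((1 - x) * ln (1 - x) - x * ln x + 1 + 1 * ln x < 0) by nra.
    nra.
Qed.

Lemma Ctilde_decreasing p q : 1 < p -> p < q -> q <= 2 -> Ctilde q < Ctilde p.
Proof.
intros Hp Hpq Hq.
assert (Hx : exists x, 0 < x <= 1 / 4 /\ Ctilde q = ell q x).
{ destruct (Rlt_le_dec q 2) as [H | H].
  - exists (argmax q); pose proof (argmax_01 q); pose proof (argmax_lt_quarter q).
    split; [lra | apply Ctilde_ell; lra].
  - exists (1 / 4); replace q with 2 by lra.
    rewrite Ctilde_2, ell_2; lra. }
destruct Hx as [x [Hx ->]]; rewrite (Ctilde_ell p) by lra.
apply Rlt_le_trans with (ell p x).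
- apply ell_decreasing_exponent; lra.
- apply ell_le_max; lra.
Qed.

(** * Solutions of polynomial differential systems are analytic *)

(** [poly_in ys k N f]: f is a polynomial in the functions of ys with degree
    at most k whose coefficients have absolute values summing to at most N.
    Recording k and N along the construction of f makes the effect of
    differentiation on both immediate, with no normal form of polynomials. *)
Inductive poly_in (ys : list (R -> R)) : nat -> R -> (R -> R) -> Prop :=
| poly_var f : In f ys -> poly_in ys 1 1 f
| poly_const c : poly_in ys 0 (Rabs c) (fun _ => c)
| poly_add k N M f g :
    poly_in ys k N f -> poly_in ys k M g ->
    poly_in ys k (N + M) (fun t => f t + g t)
| poly_mul k l N M f g :
    poly_in ys k N f -> poly_in ys l M g ->
    poly_in ys (k + l) (N * M) (fun t => f t * g t)
| poly_weaken k l N M f :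
    (k <= l)%nat -> N <= M -> poly_in ys k N f -> poly_in ys l M f.

Lemma poly_in_ge0 ys k N f : poly_in ys k N f -> 0 <= N.
Proof.
induction 1; try lra; [apply Rabs_pos | now apply Rmult_le_pos].
Qed.

Lemma poly_in_bound ys k N f B t :
  1 <= B -> (forall f, In f ys -> Rabs (f t) <= B) ->
  poly_in ys k N f -> Rabs (f t) <= N * B ^ k.
Proof.
intros HB Hys H; induction H.
- specialize (Hys _ H); simpl; lra.
- simpl; lra.
- eapply Rle_trans; [apply Rabs_triang | lra].
- rewrite Rabs_mult, pow_add.
  replace (N * M * (B ^ k * B ^ l)) with ((N * B ^ k) * (M * B ^ l)) by ring.
  apply Rmult_le_compat; auto using Rabs_pos.
- eapply Rle_trans; [apply IHpoly_in |].
  apply Rmult_le_compat; trivial.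
  + eapply poly_in_ge0; eassumption.
  + apply pow_le; lra.
  + now apply Rle_pow.
Qed.

(** The product rule turns a monomial of degree k into k monomials, in each
    of which one variable is replaced by a polynomial of degree at most 1 + e
    and coefficient sum at most K. *)
Lemma poly_in_derive ys e K lo hi :
  0 <= K ->
  (forall f, In f ys -> exists g, poly_in ys (1 + e) K g /\
     forall t, lo < t < hi -> is_derive f t (g t)) ->
  forall k N f, poly_in ys k N f ->
  exists g, poly_in ys (k + e) (INR k * K * N) g /\
    forall t, lo < t < hi -> is_derive f t (g t).
Proof.
intros HK Hys k N f H; induction H.
- destruct (Hys _ H) as [g [Hg Dg]]; exists g; split; trivial.
  simpl INR; replace (1 * K * 1) with K by ring; exact Hg.
- exists (fun _ => 0); split.
  + apply poly_weaken with (3 := poly_const ys 0); [lia |].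
    rewrite Rabs_R0; simpl; lra.
  + intros t _; auto_derive; trivial.
- destruct IHpoly_in1 as [f' [Hf' Df']], IHpoly_in2 as [g' [Hg' Dg']].
  exists (fun t => f' t + g' t); split.
  + rewrite Rmult_plus_distr_l; now apply poly_add.
  + intros t Ht; apply @is_derive_plus; auto.
- destruct IHpoly_in1 as [f' [Hf' Df']], IHpoly_in2 as [g' [Hg' Dg']].
  exists (fun t => f' t * g t + f t * g' t); split.
  + rewrite plus_INR.
    replace ((INR k + INR l) * K * (N * M))
      with (INR k * K * N * M + N * (INR l * K * M)) by ring.
    apply poly_add.
    * replace (k + l + e)%nat with (k + e + l)%nat by lia; now apply poly_mul.
    * rewrite <- Nat.add_assoc; now apply poly_mul.
  + intros t Ht; apply (is_derive_mult f g); auto.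
    exact Rmult_comm.
- destruct IHpoly_in as [g [Hg Dg]]; exists g; split; trivial.
  apply poly_weaken with (3 := Hg); [lia |].
  pose proof (poly_in_ge0 _ _ _ _ H1).
  apply Rmult_le_compat; trivial.
  + apply Rmult_le_pos; trivial; apply pos_INR.
  + apply Rmult_le_compat_r; trivial; now apply le_INR.
Qed.

(** Iterating [poly_in_derive], the coefficient sum grows by the factors
    (1 + j e) K for j < n, each of which is at most (1 + e) K (j + 1); this is
    where the factor n!, the mark of analyticity, comes from. *)
Lemma poly_in_Derive_n ys e K lo hi :
  0 <= K ->
  (forall f, In f ys -> exists g, poly_in ys (1 + e) K g /\
     forall t, lo < t < hi -> is_derive f t (g t)) ->
  forall f, In f ys -> forall n,
  exists g, poly_in ys (1 + n * e) ((INR (S e) * K) ^ n * INR (fact n)) g /\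
    forall t, lo < t < hi -> Derive_n f n t = g t.
Proof.
intros HK Hys f Hf n; induction n as [| n [g [Hg Dg]]].
- exists f; split; trivial; simpl; rewrite Rmult_1_l; now apply poly_var.
- destruct (poly_in_derive _ _ _ _ _ HK Hys _ _ _ Hg) as [g' [Hg' Dg']].
  exists g'; split.
  + apply poly_weaken with (3 := Hg'); [simpl; lia |].
    rewrite fact_simpl, mult_INR.
    replace ((INR (S e) * K) ^ S n * (INR (S n) * INR (fact n)))
      with (INR (S e) * INR (S n) * K * ((INR (S e) * K) ^ n * INR (fact n)))
      by (simpl; ring).
    apply Rmult_le_compat_r.
    * apply Rmult_le_pos; [apply pow_le, Rmult_le_pos |]; trivial;
        apply pos_INR.
    * apply Rmult_le_compat_r; trivial.
      rewrite <- mult_INR; apply le_INR; lia.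
  + intros t Ht; simpl.
    rewrite <- (is_derive_unique _ _ _ (Dg' t Ht)).
    apply Derive_ext_loc.
    apply (locally_interval _ t lo hi); try apply Ht.
    intros s Hs1 Hs2; apply Dg; split; trivial.
Qed.

(** Differentiating the Taylor sum in its base point leaves only the last
    term. *)
Lemma Taylor_sum_derive (h : nat -> R -> R) n s t :
  (forall k, (k <= n)%nat -> is_derive (h k) s (h (S k) s)) ->
  is_derive (fun s => sum_n (fun k => h k s * ((t - s) ^ k / INR (fact k))) n) s
    (h (S n) s * ((t - s) ^ n / INR (fact n))).
Proof.
intros Hh; induction n as [| n IH].
- apply is_derive_ext with (f := h O).
  + intros u; rewrite sum_O; simpl; field.
  + simpl; replace (h 1%nat s * (1 / 1)) with (h 1%nat s) by field.
    apply Hh; lia.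
- apply is_derive_ext with (f := fun s =>
    sum_n (fun k => h k s * ((t - s) ^ k / INR (fact k))) n
    + h (S n) s * ((t - s) ^ S n / INR (fact (S n)))).
  + intros u; now rewrite sum_Sn.
  + replace (h (S (S n)) s * ((t - s) ^ S n / INR (fact (S n)))) with
      (h (S n) s * ((t - s) ^ n / INR (fact n))
       + (h (S (S n)) s * ((t - s) ^ S n / INR (fact (S n)))
          + h (S n) s * (- ((t - s) ^ n / INR (fact n))))) by ring.
    apply @is_derive_plus; [apply IH; intros; apply Hh; lia |].
    apply (is_derive_mult (h (S n)) (fun s => (t - s) ^ S n / INR (fact (S n))));
      [apply Hh; lia | | exact Rmult_comm].
    auto_derive; trivial.
    change (fact n + n * fact n)%nat with (S n * fact n)%nat; rewrite mult_INR.
    change (match n with O => 1 | S _ => INR n + 1 end) with (INR (S n)).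
    assert (HS : INR (S n) <> 0) by now apply not_0_INR.
    pose proof (INR_fact_neq_0 n) as Hf.
    replace (t + - s) with (t - s) by ring.
    revert HS Hf; clear; generalize (INR (S n)) (INR (fact n)) ((t - s) ^ n).
    intros a b z Ha Hb; field; now split.
Qed.

(** Applying the mean value theorem to the Taylor sum as a function of its
    base point bounds the remainder by (n + 1) B (K |t - p0|)^(n+1). *)
Lemma analytic_of_derivative_bounds (h : nat -> R -> R) p0 r B K :
  0 < r -> 0 < K ->
  (forall n t, p0 - r < t < p0 + r -> is_derive (h n) t (h (S n) t)) ->
  (forall n t, p0 - r < t < p0 + r -> Rabs (h n t) <= B * K ^ n * INR (fact n)) ->
  real_analytic_at (h O) p0.
Proof.
intros Hr HK Hd Hb.
exists (fun n => h n p0 / INR (fact n)).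
pose (d := Rmin r (/ (2 * K))).
assert (Hd0 : 0 < d).
{ apply Rmin_pos; trivial; apply Rinv_0_lt_compat; lra. }
exists (mkposreal d Hd0); intros t Ht.
change (Rabs (t - p0) < d) in Ht.
assert (Htr : Rabs (t - p0) < r) by (eapply Rlt_le_trans; [exact Ht | apply Rmin_l]).
assert (Htk : Rabs (t - p0) < / (2 * K))
  by (eapply Rlt_le_trans; [exact Ht | apply Rmin_r]).
pose (q := 2 * K * Rabs (t - p0)).
assert (Hq : 0 <= q < 1).
{ split.
  - apply Rmult_le_pos; [lra | apply Rabs_pos].
  - unfold q; replace 1 with (2 * K * / (2 * K)) by (field; lra).
    apply Rmult_lt_compat_l; lra. }
assert (Hrem : forall n, Rabs (sum_n (fun k => scal (pow_n (t - p0) k)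
          (h k p0 / INR (fact k))) n - h O t) <= B * q ^ S n).
{ intros n.
  pose (T := fun s => sum_n (fun k => h k s * ((t - s) ^ k / INR (fact k))) n).
  assert (HI : forall s, Rmin p0 t <= s <= Rmax p0 t ->
      p0 - r < s < p0 + r /\ Rabs (t - s) <= Rabs (t - p0)).
  { apply Rabs_def2 in Htr.
    intros s; unfold Rmin, Rmax; destruct (Rle_dec p0 t); intros Hs; split;
      try lra; unfold Rabs; repeat destruct Rcase_abs; lra. }
  assert (HT : forall s, Rmin p0 t <= s <= Rmax p0 t ->
      is_derive T s (h (S n) s * ((t - s) ^ n / INR (fact n)))).
  { intros s Hs; apply Taylor_sum_derive; intros k _; apply Hd, HI, Hs. }
  destruct (MVT_gen T p0 t (fun s => h (S n) s * ((t - s) ^ n / INR (fact n))))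
    as [c [Hc Heq]].
  - intros s Hs; apply HT; lra.
  - intros s Hs; apply continuity_pt_filterlim.
    apply @ex_derive_continuous; eexists; apply HT, Hs.
  - replace (sum_n _ n) with (T p0).
    2:{ apply sum_n_ext; intros k.
        change (h k p0 * ((t - p0) ^ k / INR (fact k))
                = pow_n (t - p0) k * (h k p0 / INR (fact k))).
        rewrite (pow_n_pow (t - p0) k); unfold Rdiv; ring. }
    replace (h O t) with (T t).
    2:{ unfold T; clear -n; induction n as [| n IH].
        - rewrite sum_O; simpl; field.
        - rewrite sum_Sn, IH; change plus with Rplus; simpl.
          replace (t - t) with 0 by ring; unfold Rdiv; ring. }
    rewrite Rabs_minus_sym, Heq.
    destruct (HI c Hc) as [Hc1 Hc2].
    rewrite !Rabs_mult; unfold Rdiv; rewrite Rabs_mult, <- RPow_abs.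
    rewrite (Rabs_pos_eq (/ _)).
    2:{ apply Rlt_le, Rinv_0_lt_compat, INR_fact_lt_0. }
    assert (HB : 0 <= B).
    { specialize (Hb O c Hc1); simpl in Hb.
      pose proof (Rabs_pos (h O c)); lra. }
    apply Rle_trans with (B * K ^ S n * INR (fact (S n)) *
       (Rabs (t - p0) ^ n * / INR (fact n)) * Rabs (t - p0)).
    + apply Rmult_le_compat_r; [apply Rabs_pos |].
      apply Rmult_le_compat; try apply Rabs_pos.
      * apply Rmult_le_pos; [apply pow_le, Rabs_pos |].
        apply Rlt_le, Rinv_0_lt_compat, INR_fact_lt_0.
      * now apply Hb.
      * apply Rmult_le_compat_r.
        { apply Rlt_le, Rinv_0_lt_compat, INR_fact_lt_0. }
        apply pow_incr; split; [apply Rabs_pos | exact Hc2].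
    + rewrite fact_simpl, mult_INR.
      replace (B * K ^ S n * (INR (S n) * INR (fact n)) *
        (Rabs (t - p0) ^ n * / INR (fact n)) * Rabs (t - p0))
        with (INR (S n) * (B * (K * Rabs (t - p0)) ^ S n)).
      2:{ rewrite Rpow_mult_distr; simpl; field; apply INR_fact_neq_0. }
      unfold q; rewrite Rmult_assoc, (Rpow_mult_distr 2).
      replace (B * (2 ^ S n * (K * Rabs (t - p0)) ^ S n))
        with (2 ^ S n * (B * (K * Rabs (t - p0)) ^ S n)) by ring.
      apply Rmult_le_compat_r.
      { apply Rmult_le_pos; trivial; apply pow_le, Rmult_le_pos; [lra |].
        apply Rabs_pos. }
      clear; induction (S n) as [| m IH]; [simpl; lra |].
      rewrite S_INR; simpl pow.
      assert (1 <= 2 ^ m) by (apply pow_R1_Rle; lra); lra. }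
change (is_lim_seq (fun n => sum_n (fun k => scal (pow_n (t - p0) k)
          (h k p0 / INR (fact k))) n) (h O t)).
apply is_lim_seq_ext with (u := fun n => (sum_n (fun k => scal (pow_n (t - p0) k)
          (h k p0 / INR (fact k))) n - h O t) + h O t); [intros n; ring |].
replace (Finite (h O t)) with (Finite (0 + h O t)) by (f_equal; ring).
apply is_lim_seq_plus'; [| apply is_lim_seq_const].
apply is_lim_seq_abs_0.
apply is_lim_seq_le_le with (u := fun _ => 0) (w := fun n => B * q ^ S n).
- intros n; split; [apply Rabs_pos | apply Hrem].
- apply is_lim_seq_const.
- replace (Finite 0) with (Finite (B * 0)) by (f_equal; ring).
  apply is_lim_seq_mult'; [apply is_lim_seq_const |].
  apply (is_lim_seq_incr_1 (fun n => q ^ n)), is_lim_seq_geom.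
  rewrite Rabs_pos_eq; apply Hq.
Qed.

Lemma locally_bounded_list (ys : list (R -> R)) p0 :
  (forall f, In f ys -> continuous f p0) ->
  exists B, 1 <= B /\
    locally p0 (fun t => forall f, In f ys -> Rabs (f t) <= B).
Proof.
induction ys as [| f ys IH]; intros Hc.
- exists 1; split; [lra |]; apply filter_forall; now intros t f [].
- destruct IH as [B [HB HL]]; [intros g Hg; apply Hc; now right |].
  exists (Rmax B (Rabs (f p0) + 1)); split.
  + eapply Rle_trans; [exact HB | apply Rmax_l].
  + assert (Hf : locally p0 (fun t => Rabs (f t - f p0) < 1)).
    { apply (Hc f (or_introl eq_refl) (fun v => Rabs (v - f p0) < 1)).
      now exists (mkposreal 1 Rlt_0_1). }
    generalize (filter_and _ _ HL Hf); apply filter_imp.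
    intros t [H1 H2] g [<- | Hg].
    * eapply Rle_trans; [| apply Rmax_r].
      replace (f t) with (f p0 + (f t - f p0)) by ring.
      eapply Rle_trans; [apply Rabs_triang | lra].
    * eapply Rle_trans; [now apply H1 | apply Rmax_l].
Qed.

(** Hides degree and coefficient sum while polynomials are assembled;
    [uniform_poly_bounds] recovers common values for a finite family. *)
Definition is_poly (ys : list (R -> R)) (f : R -> R) : Prop :=
  exists k N, poly_in ys k N f.

Lemma is_poly_var ys f : In f ys -> is_poly ys f.
Proof. intros Hf; exists 1%nat, 1; now apply poly_var. Qed.

Lemma is_poly_const ys c : is_poly ys (fun _ => c).
Proof. eexists _, _; apply poly_const. Qed.

Lemma is_poly_add ys f g :
  is_poly ys f -> is_poly ys g -> is_poly ys (fun t => f t + g t).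
Proof.
intros [k [N Hf]] [l [M Hg]]; exists (Nat.max k l), (N + M).
apply poly_add.
- apply poly_weaken with (3 := Hf); [lia | lra].
- apply poly_weaken with (3 := Hg); [lia | lra].
Qed.

Lemma is_poly_mul ys f g :
  is_poly ys f -> is_poly ys g -> is_poly ys (fun t => f t * g t).
Proof.
intros [k [N Hf]] [l [M Hg]]; eexists _, _; apply poly_mul; eassumption.
Qed.

Lemma uniform_poly_bounds ys (D : (R -> R) -> (R -> R) -> Prop) zs :
  (forall f, In f zs -> exists g, is_poly ys g /\ D f g) ->
  exists e K, 0 < K /\
    forall f, In f zs -> exists g, poly_in ys (1 + e) K g /\ D f g.
Proof.
induction zs as [| f zs IH]; intros H.
- exists O, 1; split; [lra | now intros f []].
- destruct IH as [e [K [HK IH]]]; [intros f' Hf'; apply H; now right |].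
  destruct (H f (or_introl eq_refl)) as [g [[k [N Hg]] Dg]].
  exists (Nat.max e k), (Rmax K N); split.
  + eapply Rlt_le_trans; [exact HK | apply Rmax_l].
  + intros f' [<- | Hf'].
    * exists g; split; trivial.
      apply poly_weaken with (3 := Hg); [lia | apply Rmax_r].
    * destruct (IH f' Hf') as [g' [Hg' Dg']]; exists g'; split; trivial.
      apply poly_weaken with (3 := Hg'); [lia | apply Rmax_l].
Qed.

(** Near p0 the functions of ys are bounded by some B >= 1, so
    [poly_in_Derive_n] bounds the n-th derivatives by B (S K B^e)^n n! with
    S = 1 + e. *)
Theorem polynomial_ode_analytic (ys : list (R -> R)) p0 lo hi :
  lo < p0 < hi ->
  (forall f, In f ys -> exists g, is_poly ys g /\
     forall t, lo < t < hi -> is_derive f t (g t)) ->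
  forall f, In f ys -> real_analytic_at f p0.
Proof.
intros Hp0 Hpoly f Hf.
destruct (uniform_poly_bounds _ _ _ Hpoly) as [e [K [HK Hys]]].
assert (HK0 : 0 <= K) by lra.
destruct (locally_bounded_list ys p0) as [B [HB [d HL]]].
{ intros g Hg; destruct (Hys g Hg) as [g' [_ Dg]].
  apply @ex_derive_continuous; exists (g' p0); now apply Dg. }
pose (r := Rmin d (Rmin (p0 - lo) (hi - p0))).
assert (Hr : 0 < r).
{ apply Rmin_pos; [apply cond_pos | apply Rmin_pos; lra]. }
assert (HI : forall t, p0 - r < t < p0 + r -> lo < t < hi /\ Rabs (t - p0) < d).
{ intros t Ht.
  assert (r <= d) by apply Rmin_l.
  assert (r <= Rmin (p0 - lo) (hi - p0)) by apply Rmin_r.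
  pose proof (Rmin_l (p0 - lo) (hi - p0)).
  pose proof (Rmin_r (p0 - lo) (hi - p0)).
  split; [lra |]; apply Rabs_def1; lra. }
assert (He : 0 < INR (S e)) by (apply lt_0_INR; lia).
change f with (Derive_n f 0).
apply analytic_of_derivative_bounds
  with (r := r) (B := B) (K := INR (S e) * K * B ^ e); trivial.
- apply Rmult_lt_0_compat; [now apply Rmult_lt_0_compat |].
  apply pow_lt; lra.
- intros n t Ht.
  destruct (poly_in_Derive_n _ _ _ _ _ HK0 Hys f Hf n) as [g [Hg Dg]].
  destruct (poly_in_derive _ _ _ _ _ HK0 Hys _ _ _ Hg) as [g' [_ Dg']].
  destruct (HI t Ht) as [Ht' _].
  apply Derive_correct; exists (g' t).
  apply is_derive_ext_loc with (f := g); [| now apply Dg'].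
  apply (locally_interval _ t lo hi); try apply Ht'.
  intros s Hs1 Hs2; symmetry; apply Dg; split; trivial.
- intros n t Ht; destruct (HI t Ht) as [Ht' Htd].
  destruct (poly_in_Derive_n _ _ _ _ _ HK0 Hys f Hf n) as [g [Hg Dg]].
  rewrite (Dg t Ht').
  eapply Rle_trans; [apply (poly_in_bound ys) with (B := B); trivial |].
  + now apply HL.
  + exact Hg.
  + apply Req_le; rewrite pow_add, !Rpow_mult_distr, <- pow_mult, (Nat.mul_comm e n).
    simpl; ring.
Qed.

(** * Differentiability of implicit functions *)

(** The linear approximation of F at the point first gives
    |x p - x p0| <= M |p - p0|; with this, the error of the approximation is
    small relative to p - p0 alone. *)
Lemma is_derive_implicit (F : R -> R -> R) (x : R -> R) p0 Fp Fx :
  differentiable_pt_lim F p0 (x p0) Fp Fx -> Fx <> 0 -> continuous x p0 ->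
  locally p0 (fun p => F p (x p) = F p0 (x p0)) ->
  is_derive x p0 (- Fp / Fx).
Proof.
intros HF HFx Hc Hloc; apply is_derive_Reals; intros eps Heps.
assert (HaF : 0 < Rabs Fx) by now apply Rabs_pos_lt.
pose (M := 2 * Rabs Fp / Rabs Fx + 1).
assert (HM : 1 <= M).
{ enough (0 <= 2 * Rabs Fp / Rabs Fx) by (unfold M; lra).
  apply Rmult_le_pos; [pose proof (Rabs_pos Fp); lra |].
  now apply Rlt_le, Rinv_0_lt_compat. }
pose (e := Rmin (Rabs Fx / 2) (eps * Rabs Fx / (2 * M))).
assert (He : 0 < e).
{ apply Rmin_pos; [lra | apply Rdiv_lt_0_compat; [nra | lra]]. }
destruct (HF (mkposreal e He)) as [d Hd]; simpl in Hd.
assert (Hcd : locally p0 (fun p => Rabs (x p - x p0) < d)).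
{ apply (Hc (fun v => Rabs (v - x p0) < d)); now exists d. }
destruct (filter_and _ _ Hcd Hloc) as [d' Hd'].
pose (r := Rmin d d').
assert (Hr : 0 < r) by (apply Rmin_pos; apply cond_pos).
exists (mkposreal r Hr); simpl; intros h Hh0 Hh.
assert (Hhd : Rabs h < d) by (eapply Rlt_le_trans; [exact Hh | apply Rmin_l]).
assert (Hhd' : Rabs h < d') by (eapply Rlt_le_trans; [exact Hh | apply Rmin_r]).
destruct (Hd' (p0 + h)) as [Hxk Heq].
{ change (Rabs (p0 + h - p0) < d'); now replace (p0 + h - p0) with h by ring. }
specialize (Hd (p0 + h) (x (p0 + h))).
rewrite Heq in Hd; replace (p0 + h - p0) with h in Hd by ring.
specialize (Hd Hhd Hxk); revert Hd; set (k := x (p0 + h) - x p0); intros Hd.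
replace (F p0 (x p0) - F p0 (x p0) - (Fp * h + Fx * k)) with (- (Fp * h + Fx * k))
  in Hd by ring.
rewrite Rabs_Ropp in Hd.
assert (Hah : 0 < Rabs h) by now apply Rabs_pos_lt.
assert (He1 : e <= Rabs Fx / 2) by apply Rmin_l.
assert (He2 : e * M <= eps * Rabs Fx / 2).
{ replace (eps * Rabs Fx / 2) with (eps * Rabs Fx / (2 * M) * M) by (field; lra).
  apply Rmult_le_compat_r; [lra | apply Rmin_r]. }
assert (Hk : Rabs k <= M * Rabs h).
{ assert (H1 : Rabs Fx * Rabs k <= Rabs Fp * Rabs h + Rabs (Fp * h + Fx * k)).
  { rewrite <- !Rabs_mult.
    replace (Fx * k) with (- (Fp * h) + (Fp * h + Fx * k)) at 1 by ring.
    eapply Rle_trans; [apply Rabs_triang |]; rewrite Rabs_Ropp; lra. }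
  destruct (Rle_lt_dec (Rabs k) (Rabs h)) as [Hkh | Hkh]; [nra |].
  rewrite Rmax_right in Hd by lra.
  assert (H2 : Rabs Fx / 2 * Rabs k <= Rabs Fp * Rabs h).
  { pose proof (Rabs_pos k); nra. }
  apply Rmult_le_reg_l with (Rabs Fx / 2); [lra |].
  unfold M.
  replace (Rabs Fx / 2 * ((2 * Rabs Fp / Rabs Fx + 1) * Rabs h))
    with (Rabs Fp * Rabs h + Rabs Fx / 2 * Rabs h) by (field; lra).
  nra. }
assert (Hmax : Rmax (Rabs h) (Rabs k) <= M * Rabs h) by (apply Rmax_lub; nra).
replace (k / h - - Fp / Fx) with ((Fp * h + Fx * k) / (Fx * h)) by (field; auto).
unfold Rdiv; rewrite Rabs_mult, Rabs_inv, Rabs_mult.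
apply Rmult_lt_reg_r with (Rabs Fx * Rabs h); [nra |].
rewrite Rmult_assoc, Rinv_l by nra.
assert (e * Rmax (Rabs h) (Rabs k) <= e * (M * Rabs h))
  by (apply Rmult_le_compat_l; lra).
assert (0 < eps * Rabs Fx * Rabs h) by (repeat apply Rmult_lt_0_compat; lra).
nra.
Qed.

(** * Analyticity in the exponent *)

Lemma continuous_slope_exponent p x : continuous (fun p => slope p x) p.
Proof.
apply (ex_derive_continuous (fun p => slope p x)).
unfold slope, Rpower; auto_derive; trivial.
Qed.

(** The slope is positive just left and negative just right of argmax p; by
    continuity in the exponent these signs persist for nearby exponents and
    enclose their zeros. *)
Lemma continuous_argmax p : 1 < p < 2 -> continuous argmax p.
Proof.
intros Hp; apply filterlim_locally; intros eps.
pose proof (argmax_critical p Hp) as [Hx [_ [Hl Hr]]].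
pose (e := Rmin eps (Rmin (argmax p / 2) ((1 - argmax p) / 2))).
assert (He : 0 < e).
{ repeat apply Rmin_pos; [apply cond_pos | lra | lra]. }
assert (He1 : e <= argmax p / 2) by (eapply Rle_trans; [apply Rmin_r | apply Rmin_l]).
assert (He2 : e <= (1 - argmax p) / 2)
  by (eapply Rle_trans; [apply Rmin_r | apply Rmin_r]).
assert (He3 : e <= eps) by apply Rmin_l.
assert (L1 : locally p (fun q => 0 < slope q (argmax p - e))).
{ apply (continuous_slope_exponent p (argmax p - e) (fun v => 0 < v)).
  apply (open_gt 0); apply Hl; lra. }
assert (L2 : locally p (fun q => slope q (argmax p + e) < 0)).
{ apply (continuous_slope_exponent p (argmax p + e) (fun v => v < 0)).
  apply (open_lt 0); apply Hr; lra. }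
assert (L3 : locally p (fun q => 1 < q < 2)).
{ apply (locally_interval _ p 1 2); simpl; try lra; auto. }
generalize (filter_and _ _ L3 (filter_and _ _ L1 L2)); apply filter_imp.
intros q [Hq [H1 H2]]; pose proof (argmax_critical q Hq) as Hc.
change (Rabs (argmax q - argmax p) < eps).
assert (argmax p - e < argmax q) by (apply (critical_gt q); trivial; lra).
assert (argmax q < argmax p + e) by (apply (critical_lt q); trivial; lra).
apply Rabs_def1; lra.
Qed.

(** The logarithmic form of [argmax_eq]: its partial derivative in x is
    rational and vanishes nowhere. *)
Definition log_slope (p x : R) : R :=
  ln (p - 1 - x) + (p - 2) * ln x - (p - 1) * ln (1 - x).

Lemma log_slope_argmax p : 1 < p < 2 -> log_slope p (argmax p) = 0.
Proof.
intros Hp; pose proof (argmax_eq p Hp) as H.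
pose proof (argmax_bounds p Hp); pose proof (argmax_01 p Hp).
apply (f_equal ln) in H.
rewrite ln_mult in H; [| lra | apply Rpower_gt0].
rewrite !ln_Rpower in H; unfold log_slope; lra.
Qed.

Lemma differentiable_log_slope p x : 0 < x < 1 -> x < p - 1 ->
  differentiable_pt_lim log_slope p x
    (/ (p - 1 - x) + ln x - ln (1 - x))
    ((p - 1) * (p - 2) / (x * (1 - x) * (p - 1 - x))).
Proof.
intros Hx Hpx; apply filterdiff_differentiable_pt_lim.
apply (is_derive_filterdiff log_slope p x
  (fun p x => / (p - 1 - x) + ln x - ln (1 - x))).
- assert (Hr : 0 < (p - 1 - x) / 2) by lra.
  exists (mkposreal _ Hr); intros [q y] [Hq Hy]; simpl in *.
  change (Rabs (q - p) < (p - 1 - x) / 2) in Hq.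
  change (Rabs (y - x) < (p - 1 - x) / 2) in Hy.
  apply Rabs_def2 in Hq; apply Rabs_def2 in Hy.
  unfold log_slope; auto_derive; [lra |].
  unfold Rminus; field; lra.
- unfold log_slope; auto_derive; [lra | field; lra].
- assert (Hln : forall f : R * R -> R, continuous f (p, x) -> 0 < f (p, x) ->
     continuous (fun u => ln (f u)) (p, x)).
  { intros f Hf Hf0; apply (continuous_comp f ln); trivial.
    apply (ex_derive_continuous ln); auto_derive; trivial. }
  apply (continuous_minus (fun u => / (fst u - 1 - snd u) + ln (snd u))).
  + apply (continuous_plus (fun u => / (fst u - 1 - snd u))).
    * apply (continuous_comp (fun u : R * R => fst u - 1 - snd u) Rinv).
      -- apply (continuous_minus (fun u : R * R => fst u - 1)).
         ++ apply (continuous_minus (fun u : R * R => fst u));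
              [apply continuous_fst | apply continuous_const].
         ++ apply continuous_snd.
      -- apply (ex_derive_continuous Rinv); auto_derive; simpl; lra.
    * apply Hln; [apply continuous_snd | simpl; lra].
  + apply Hln; [| simpl; lra].
    apply (continuous_minus (fun _ : R * R => 1));
      [apply continuous_const | apply continuous_snd].
Qed.

(** The quotient of the partial derivatives of [log_slope], written as the
    product needed for [Ctilde_analytic]. *)
Definition argmax_deriv (p : R) : R :=
  argmax p * (1 - argmax p)
  * (1 - (p - 1 - argmax p) * (ln (1 - argmax p) - ln (argmax p)))
  * / (p - 1) * / (2 - p).

Lemma is_derive_argmax p : 1 < p < 2 -> is_derive argmax p (argmax_deriv p).
Proof.
intros Hp; pose proof (argmax_bounds p Hp); pose proof (argmax_01 p Hp).
replace (argmax_deriv p) with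
  (- (/ (p - 1 - argmax p) + ln (argmax p) - ln (1 - argmax p)) /
   ((p - 1) * (p - 2) / (argmax p * (1 - argmax p) * (p - 1 - argmax p)))).
2:{ unfold argmax_deriv; field; lra. }
apply is_derive_implicit with log_slope.
- apply differentiable_log_slope; lra.
- apply Rmult_integral_contrapositive_currified; [nra |].
  apply Rinv_neq_0_compat; repeat apply Rmult_integral_contrapositive_currified; lra.
- now apply continuous_argmax.
- apply (locally_interval _ p 1 2); simpl; try lra.
  intros q Hq1 Hq2; rewrite !log_slope_argmax; trivial; split; trivial.
Qed.

Lemma real_analytic_at_ext F G p0 :
  locally p0 (fun p => F p = G p) -> real_analytic_at F p0 -> real_analytic_at G p0.
Proof.
intros HFG [a Ha]; exists a.
generalize (filter_and _ _ HFG Ha); apply filter_imp.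
now intros p [<- H].
Qed.

Ltac poly := repeat
  ((apply is_poly_var; simpl; tauto)
   || apply is_poly_add || apply is_poly_mul || apply is_poly_const).

Lemma Ctilde_analytic p : 1 < p < 2 -> real_analytic_at Ctilde p.
Proof.
intros Hp.
pose (C := fun p => (p - 1) * exp ((p - 2) * ln (argmax p))).
apply real_analytic_at_ext with C.
{ apply (locally_interval _ p 1 2); simpl; try lra.
  intros q Hq1 Hq2; rewrite Ctilde_argmax; trivial; split; trivial. }
pose (id := fun p : R => p).
pose (r1 := fun p => / (p - 1)).
pose (r2 := fun p => / (2 - p)).
pose (l0 := fun p => ln (argmax p)).
pose (l1 := fun p => ln (1 - argmax p)).
pose (ys := id :: r1 :: r2 :: argmax :: l0 :: l1 :: C :: nil).
(* g and h are the derivatives of ln argmax and of ln (1 - argmax), with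
   differences spelled as sums so that they match the closure lemmas. *)
pose (g := fun t => (1 + -1 * argmax t)
  * (1 + -1 * (id t + -1 + -1 * argmax t) * (l1 t + -1 * l0 t)) * r1 t * r2 t).
pose (h := fun t => -1 * argmax t
  * (1 + -1 * (id t + -1 + -1 * argmax t) * (l1 t + -1 * l0 t)) * r1 t * r2 t).
assert (Hx : forall t, 1 < t < 2 -> 0 < argmax t < 1 /\
   is_derive argmax t (argmax t * g t)).
{ intros t Ht; split; [now apply argmax_01 |].
  replace (argmax t * g t) with (argmax_deriv t); [now apply is_derive_argmax |].
  unfold argmax_deriv, g, id, r1, r2, l0, l1; ring. }
assert (Hl0 : forall t, 1 < t < 2 -> is_derive l0 t (g t)).
{ intros t Ht; destruct (Hx t Ht) as [Ht1 Dt].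
  unfold l0; evar_last.
  - apply (is_derive_comp ln argmax); [| exact Dt].
    apply is_derive_Reals, derivable_pt_lim_ln; lra.
  - change scal with Rmult; simpl; field; lra. }
apply (polynomial_ode_analytic ys p 1 2); trivial.
2: simpl; tauto.
intros f Hf; simpl in Hf.
destruct Hf as [<- | [<- | [<- | [<- | [<- | [<- | [<- | []]]]]]]].
- exists (fun _ => 1); split; [poly |].
  intros t _; unfold id; auto_derive; trivial.
- exists (fun t => -1 * (r1 t * r1 t)); split; [poly |].
  intros t Ht; unfold r1; auto_derive; [lra | field; lra].
- exists (fun t => r2 t * r2 t); split; [poly |].
  intros t Ht; unfold r2; auto_derive; [lra | field; lra].
- exists (fun t => argmax t * g t); split; [unfold g; poly |].
  intros t Ht; now apply Hx.
- exists g; split; [unfold g; poly | trivial].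
- exists h; split; [unfold h; poly |].
  intros t Ht; destruct (Hx t Ht) as [Ht1 Dt]; unfold l1.
  evar_last.
  + apply (is_derive_comp ln (fun t => 1 - argmax t)).
    * apply is_derive_Reals, derivable_pt_lim_ln; lra.
    * apply (is_derive_minus (fun _ => 1)); [| exact Dt].
      apply is_derive_const.
  + change scal with Rmult; change minus with Rminus; change zero with 0; simpl.
    unfold g, h; field; lra.
- exists (fun t => C t * (r1 t + l0 t + (id t + -2) * g t)).
  split; [unfold g; poly |].
  intros t Ht; unfold C.
  assert (D1 : is_derive (fun t => t - 1) t 1) by (auto_derive; trivial; ring).
  assert (D2 : is_derive (fun t => exp ((t - 2) * l0 t)) t
    ((l0 t + (t - 2) * g t) * exp ((t - 2) * l0 t))).
  { apply (is_derive_comp exp (fun t => (t - 2) * l0 t)).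
    - apply is_derive_Reals, derivable_pt_lim_exp.
    - evar_last.
      + apply (is_derive_mult (fun t => t - 2)); [| now apply Hl0 | exact Rmult_comm].
        auto_derive; trivial.
      + change plus with Rplus; change mult with Rmult; simpl; ring. }
  evar_last.
  + apply (is_derive_mult _ _ _ _ _ D1 D2 Rmult_comm).
  + change plus with Rplus; change mult with Rmult; simpl.
    unfold r1, id, l0; field; lra.
Qed.

(** * Comparison with the explicit bounds *)

(** The tangent at t of [ell p] as a function of (1 - x)^2. *)
Definition tangent_bound (p t x : R) : R :=
  ell p t + p * weighted_slope p t / 2 * ((1 - t) ^ 2 - (1 - x) ^ 2).

(** The derivative in x of the difference is
    p (1 - x) (weighted_slope p t - weighted_slope p x), which has the sign of
    x - t. *)
Lemma ell_lt_tangent_bound p t x : 1 < p < 2 -> 0 < t < p - 1 -> 0 < x < p - 1 ->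
  x <> t -> ell p x < tangent_bound p t x.
Proof.
intros Hp Ht Hx Hne.
pose (f := fun y => tangent_bound p t y - ell p y).
assert (Hd : forall y, 0 < y < p - 1 ->
  is_derive f y (p * (1 - y) * (weighted_slope p t - weighted_slope p y))).
{ intros y Hy; unfold f, tangent_bound.
  replace (p * _ * _) with (p * weighted_slope p t * (1 - y) - p * slope p y)
    by (rewrite slope_eq_weighted by lra; ring).
  apply (is_derive_minus (fun y => tangent_bound p t y)).
  - unfold tangent_bound; auto_derive; trivial; field.
  - apply is_derive_ell; lra. }
assert (H0 : f t = 0) by (unfold f, tangent_bound; ring).
enough (f t < f x) by (unfold f in *; lra).
destruct (Rtotal_order x t) as [H | [H | H]]; [| easy |].
- apply lt_of_derive_lt0
    with (df := fun y => p * (1 - y) * (weighted_slope p t - weighted_slope p y));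
    [exact H | intros y Hy; apply Hd; lra |].
  intros y Hy; assert (weighted_slope p t < weighted_slope p y)
    by (apply weighted_slope_decreasing; lra).
  assert (0 < p * (1 - y)) by (apply Rmult_lt_0_compat; lra); nra.
- apply lt_of_derive_gt0
    with (df := fun y => p * (1 - y) * (weighted_slope p t - weighted_slope p y));
    [exact H | intros y Hy; apply Hd; lra |].
  intros y Hy; assert (weighted_slope p y < weighted_slope p t)
    by (apply weighted_slope_decreasing; lra).
  repeat apply Rmult_lt_0_compat; lra.
Qed.

Lemma ell_Rpower_pred p x : 0 < x < 1 ->
  ell p x = (1 - x) * Rpower (1 - x) (p - 1) + (p - x) * Rpower x (p - 1).
Proof.
intros Hx; unfold ell; rewrite !Rpower_pred by lra; field; lra.
Qed.

Lemma weighted_slope_Rpower_pred p x : 0 < x < 1 -> weighted_slope p x =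
  ((p - 1 - x) / x * Rpower x (p - 1) - Rpower (1 - x) (p - 1)) / (1 - x).
Proof.
intros Hx; unfold weighted_slope; rewrite !Rpower_pred2 by lra; field; lra.
Qed.

Lemma Rpower_opp_pred c p : 0 < c -> Rpower c (- p) = / (c * Rpower c (p - 1)).
Proof.
intros Hc; rewrite Rpower_Ropp, Rpower_pred by trivial.
pose proof (Rpower_gt0 c p); f_equal; field; lra.
Qed.

Lemma Cm1_ell p : 1 < p < 2 -> Cm1 p = ell p ((p - 1) / 2).
Proof.
intros Hp; rewrite ell_Rpower_pred by lra; unfold Cm1.
replace (1 - (p - 1) / 2) with ((3 - p) / 2) by field.
rewrite !Rpower_div, Rpower_opp_pred by lra.
replace (Rpower (3 - p) p) with ((3 - p) * Rpower (3 - p) (p - 1))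
  by (rewrite Rpower_pred by lra; field; lra).
pose proof (Rpower_gt0 2 (p - 1)); field; lra.
Qed.

Lemma Cm2_ell p : 1 < p < 2 -> Cm2 p = ell p ((p - 1) / 5).
Proof.
intros Hp; rewrite ell_Rpower_pred by lra; unfold Cm2.
replace (1 - (p - 1) / 5) with ((6 - p) / 5) by field.
rewrite !Rpower_div, Rpower_opp_pred by lra.
replace (Rpower (6 - p) p) with ((6 - p) * Rpower (6 - p) (p - 1))
  by (rewrite Rpower_pred by lra; field; lra).
pose proof (Rpower_gt0 5 (p - 1)); field; lra.
Qed.

Lemma Cp1_tangent_bound p : 1 < p < 2 ->
  Cp1 p = tangent_bound p ((p - 1) / 2) ((p - 1) / 5).
Proof.
intros Hp; unfold tangent_bound; rewrite ell_Rpower_pred, weighted_slope_Rpower_pred by lra.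
unfold Cp1.
replace (1 - (p - 1) / 2) with ((3 - p) / 2) by field.
rewrite !Rpower_div, Rpower_opp_pred by lra.
pose proof (Rpower_gt0 2 (p - 1)); field; lra.
Qed.

Lemma Cp2_tangent_bound p : 1 < p < 2 ->
  Cp2 p = tangent_bound p ((p - 1) / 5) ((p - 1) / 2).
Proof.
intros Hp; unfold tangent_bound; rewrite ell_Rpower_pred, weighted_slope_Rpower_pred by lra.
unfold Cp2.
replace (1 - (p - 1) / 5) with ((6 - p) / 5) by field.
rewrite !Rpower_div, Rpower_opp_pred by lra.
pose proof (Rpower_gt0 5 (p - 1)); field; lra.
Qed.

Lemma Cm1_lt_Ctilde p : 1 < p < 2 -> Cm1 p < Ctilde p.
Proof.
intros Hp; rewrite Cm1_ell, Ctilde_ell by trivial.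
pose proof (argmax_bounds p Hp); apply ell_lt_max; lra.
Qed.

Lemma Cm2_lt_Ctilde p : 1 < p < 2 -> Cm2 p < Ctilde p.
Proof.
intros Hp; rewrite Cm2_ell, Ctilde_ell by trivial.
pose proof (argmax_bounds p Hp); apply ell_lt_max; lra.
Qed.

(** The tangent at (p - 1) / 2 is decreasing in x, and
    argmax p > (p - 1) / 5. *)
Lemma Ctilde_lt_Cp1 p : 1 < p < 2 -> Ctilde p < Cp1 p.
Proof.
intros Hp; rewrite Cp1_tangent_bound, Ctilde_ell by trivial.
pose proof (argmax_bounds p Hp) as Hx.
eapply Rlt_le_trans; [apply ell_lt_tangent_bound with (t := (p - 1) / 2); lra |].
unfold tangent_bound.
assert (Hw : weighted_slope p ((p - 1) / 2) < 0).
{ pose proof (slope_half p Hp) as Hs; rewrite slope_eq_weighted in Hs by lra; nra. }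
assert ((1 - argmax p) ^ 2 <= (1 - (p - 1) / 5) ^ 2) by (apply pow_incr; lra).
enough (0 <= p * - weighted_slope p ((p - 1) / 2)
  * ((1 - (p - 1) / 5) ^ 2 - (1 - argmax p) ^ 2)) by lra.
repeat apply Rmult_le_pos; lra.
Qed.

(** The tangent at (p - 1) / 5 is increasing in x, and
    argmax p < (p - 1) / 2. *)
Lemma Ctilde_lt_Cp2 p : 1 < p < 2 -> Ctilde p < Cp2 p.
Proof.
intros Hp; rewrite Cp2_tangent_bound, Ctilde_ell by trivial.
pose proof (argmax_bounds p Hp) as Hx.
eapply Rlt_le_trans; [apply ell_lt_tangent_bound with (t := (p - 1) / 5); lra |].
unfold tangent_bound.
assert (Hw : 0 < weighted_slope p ((p - 1) / 5)).
{ pose proof (slope_fifth p Hp) as Hs; rewrite slope_eq_weighted in Hs by lra; nra. }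
assert ((1 - (p - 1) / 2) ^ 2 <= (1 - argmax p) ^ 2) by (apply pow_incr; lra).
enough (0 <= p * weighted_slope p ((p - 1) / 5)
  * ((1 - argmax p) ^ 2 - (1 - (p - 1) / 2) ^ 2)) by lra.
repeat apply Rmult_le_pos; lra.
Qed.

(** * The second upper bound lies below W *)

(** h is a lower bound of - ln of the left-hand side, through
    ln (1 / a) >= 2 (1 - a) / (1 + a) and ln (5/2) >= 8/9.  The bound is exact
    at a = 0. *)
Lemma Rpower_small_base_le a : 0 < a <= 1 / 4 ->
  let h := a * (8 / 9 + 2 * (1 - a) / (1 + a)) in
  Rpower (2 * a / 5) a <= / (1 + h + h ^ 2 / 2).
Proof.
intros Ha h.
assert (Hh : 0 <= h).
{ apply Rmult_le_pos; [lra |].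
  assert (0 <= 2 * (1 - a) / (1 + a)); [| lra].
  apply Rmult_le_pos; [lra | apply Rlt_le, Rinv_0_lt_compat; lra]. }
apply Rle_trans with (exp (- h)).
- unfold Rpower; apply exp_le_exp.
  assert (Hia : 1 <= / a) by (rewrite <- Rinv_1; apply Rinv_le_contravar; lra).
  pose proof (ln_ge_pade (/ a) Hia) as H1; pose proof ln_5_2_bounds.
  replace (2 * a / 5) with (/ (5 / 2 * / a)) by (field; lra).
  rewrite ln_Rinv, ln_mult by (try apply Rmult_lt_0_compat; lra).
  replace (2 * (/ a - 1) / (/ a + 1)) with (2 * (1 - a) / (1 + a)) in H1
    by (field; lra).
  unfold h; nra.
- rewrite exp_Ropp; apply Rinv_le_contravar.
  + pose proof (pow2_ge_0 h); lra.
  + pose proof (exp_ge_cubic h); pose proof (pow_le h 3 Hh); lra.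
Qed.

(** e is an upper bound of ln of 5/2 times the left-hand side.  The constant
    2/5, the value at a = 1, is kept outside the exponential, so that e
    vanishes and the bound is exact at a = 1. *)
Lemma Rpower_large_base_le a : 0 < a < 1 ->
  let e := (1 - a) * (14 / 15 - 2 * a / (1 + a)) in
  Rpower (2 * a / 5) a <= 2 / 5 * / (1 - e + e ^ 2 / 2 - e ^ 3 / 6).
Proof.
intros Ha e.
assert (He : e < 1).
{ assert (0 <= 2 * a / (1 + a))
    by (apply Rmult_le_pos; [lra | apply Rlt_le, Rinv_0_lt_compat; lra]).
  unfold e; nra. }
apply Rle_trans with (2 / 5 * exp e).
- replace (2 / 5 * exp e) with (exp (- ln (5 / 2) + e))
    by (rewrite exp_plus, exp_Ropp, exp_ln by lra; field).
  unfold Rpower; apply exp_le_exp.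
  assert (Hia : 1 <= / a) by (rewrite <- Rinv_1; apply Rinv_le_contravar; lra).
  pose proof (ln_ge_pade (/ a) Hia) as H1; pose proof ln_5_2_bounds.
  replace (2 * a / 5) with (/ (5 / 2 * / a)) by (field; lra).
  rewrite ln_Rinv, ln_mult by (try apply Rmult_lt_0_compat; lra).
  replace (2 * (/ a - 1) / (/ a + 1)) with (2 * (1 - a) / (1 + a)) in H1
    by (field; lra).
  replace e with ((1 - a) * (14 / 15) - a * (2 * (1 - a) / (1 + a)))
    by (unfold e; field; lra).
  nra.
- apply Rmult_le_compat_l; [lra |].
  replace (exp e) with (/ exp (- e)) by (rewrite exp_Ropp, Rinv_inv; trivial).
  apply Rinv_le_contravar.
  + pose proof (pow2_ge_0 e); nra.
  + pose proof (exp_ge_cubic (- e)); lra.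
Qed.

(** Pairing each negative term of degree above 3 with a positive one of the
    preceding degree leaves a cubic that is positive on this interval. *)
Lemma small_exponent_polynomial_gt0 a : 0 <= a <= 1 / 4 ->
  0 < 31500 - 35365 * a - 477970 * a ^ 2 + 914778 * a ^ 3 - 632450 * a ^ 4
      + 65861 * a ^ 5 + 70596 * a ^ 6 - 23050 * a ^ 7 + 2100 * a ^ 8.
Proof.
intros Ha.
assert (0 < 31500 - 35365 * a - 477970 * a ^ 2 + 756665 * a ^ 3) by nra.
assert (0 <= a ^ 3 * (158113 - 632450 * a))
  by (apply Rmult_le_pos; [apply pow_le |]; lra).
assert (0 <= a ^ 6 * (70596 - 23050 * a))
  by (apply Rmult_le_pos; [apply pow_le |]; lra).
assert (0 <= a ^ 5) by (apply pow_le; lra).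
assert (0 <= a ^ 8) by (apply pow_le; lra).
lra.
Qed.

(** After the shift a = s + 1/4 the coefficients can be grouped into
    quadratic factors that are positive for 0 <= s <= 3/4, times powers
    of s. *)
Lemma large_exponent_polynomial_gt0 a : 1 / 4 <= a <= 1 ->
  0 < - 337000 + 3678900 * a - 7979785 * a ^ 2 + 16362550 * a ^ 3
      - 41145666 * a ^ 4 + 67430640 * a ^ 5 - 29395397 * a ^ 6
      - 873330 * a ^ 7 + 3684832 * a ^ 8 - 981760 * a ^ 9 + 86016 * a ^ 10.
Proof.
intros Ha; pose (s := a - 1 / 4); replace a with (s + 1 / 4) by (unfold s; ring).
assert (Hs : 0 <= s <= 3 / 4) by (unfold s; lra); clearbody s.
assert (Hk : forall k, 0 <= s ^ k) by (intros k; apply pow_le; lra).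
assert (0 <= s * (26 - 46 * s + 162 * s ^ 2)) by (apply Rmult_le_pos; nra).
assert (0 <= s ^ 4 * (316 + 492 * s - 508 * s ^ 2)) by (apply Rmult_le_pos; trivial; nra).
assert (0 <= s ^ 7 * (87 + 33 * s - 16 * s ^ 2)) by (apply Rmult_le_pos; trivial; nra).
pose proof (Hk 2%nat); pose proof (Hk 3%nat); pose proof (Hk 4%nat).
pose proof (Hk 5%nat); pose proof (Hk 6%nat); pose proof (Hk 7%nat).
pose proof (Hk 8%nat); pose proof (Hk 9%nat); pose proof (Hk 10%nat).
lra.
Qed.

(** With a = p - 1, this is the inequality Cp2 p < W p multiplied by
    40 (5 - a) 2^a.  Both sides agree at a = 0 and a = 1, hence the second
    power is bounded by Bernoulli's inequality, which is exact at both ends,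
    and the first one by a bound exact at a = 0 for a <= 1/4 and by another
    one exact at a = 1 for larger a.  What remains is a polynomial
    inequality with the factor a or 1 - a. *)
Lemma Cp2_W_inequality a : 0 < a < 1 ->
  (200 + 360 * a + 124 * a ^ 2 - 84 * a ^ 3) * Rpower (2 * a / 5) a
  + (200 - 140 * a - 31 * a ^ 2 + 21 * a ^ 3) * Rpower (2 * (5 - a) / 5) a
  < 80 * (5 - a).
Proof.
intros Ha.
set (P := 200 + 360 * a + 124 * a ^ 2 - 84 * a ^ 3).
set (Q := 200 - 140 * a - 31 * a ^ 2 + 21 * a ^ 3).
assert (HP : 0 < P) by (unfold P; nra).
assert (HQ : 0 < Q) by (unfold Q; nra).
assert (HB : Rpower (2 * (5 - a) / 5) a <= 1 + a * (2 * (5 - a) / 5 - 1))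
  by (apply Rpower_le_bernoulli; lra).
apply Rle_lt_trans with (P * Rpower (2 * a / 5) a
   + Q * (1 + a * (2 * (5 - a) / 5 - 1))); [nra |].
destruct (Rle_lt_dec a (1 / 4)) as [H | H].
- assert (Hh := Rpower_small_base_le a (conj (proj1 Ha) H)); simpl in Hh.
  pose (h := a * (8 / 9 + 2 * (1 - a) / (1 + a))); fold h in Hh.
  assert (HD : 0 < 1 + h + h ^ 2 / 2).
  { pose proof (pow2_ge_0 (1 + h)); nra. }
  assert (HN : P + (Q * (1 + a * (2 * (5 - a) / 5 - 1)) - 80 * (5 - a))
      * (1 + h + h ^ 2 / 2) < 0).
  { enough (0 < - (P + (Q * (1 + a * (2 * (5 - a) / 5 - 1)) - 80 * (5 - a))
      * (1 + h + h ^ 2 / 2))) by lra.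
    replace (- _) with (a * (31500 - 35365 * a - 477970 * a ^ 2 + 914778 * a ^ 3
      - 632450 * a ^ 4 + 65861 * a ^ 5 + 70596 * a ^ 6 - 23050 * a ^ 7
      + 2100 * a ^ 8) * / (405 * (1 + a) ^ 2)) by (unfold P, Q, h; field; lra).
    apply Rmult_lt_0_compat; [apply Rmult_lt_0_compat |]; [lra | |].
    - apply small_exponent_polynomial_gt0; lra.
    - apply Rinv_0_lt_compat, Rmult_lt_0_compat; [lra | apply pow_lt; lra]. }
  apply Rle_lt_trans with (P * / (1 + h + h ^ 2 / 2)
    + Q * (1 + a * (2 * (5 - a) / 5 - 1))).
  { simpl; nra. }
  apply Rmult_lt_reg_r with (1 + h + h ^ 2 / 2); trivial.
  rewrite Rmult_plus_distr_r, (Rmult_assoc P), Rinv_l by lra; lra.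
- assert (He := Rpower_large_base_le a Ha); simpl in He.
  pose (e := (1 - a) * (14 / 15 - 2 * a / (1 + a))); fold e in He.
  assert (HD : 0 < 1 - e + e ^ 2 / 2 - e ^ 3 / 6).
  { assert (He1 : e < 1).
    { assert (0 <= 2 * a / (1 + a))
        by (apply Rmult_le_pos; [lra | apply Rlt_le, Rinv_0_lt_compat; lra]).
      unfold e; nra. }
    pose proof (pow2_ge_0 e); nra. }
  assert (HN : P * (2 / 5) + (Q * (1 + a * (2 * (5 - a) / 5 - 1)) - 80 * (5 - a))
      * (1 - e + e ^ 2 / 2 - e ^ 3 / 6) < 0).
  { enough (0 < - (P * (2 / 5) + (Q * (1 + a * (2 * (5 - a) / 5 - 1)) - 80 * (5 - a))
      * (1 - e + e ^ 2 / 2 - e ^ 3 / 6))) by lra.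
    replace (- _) with ((1 - a) * (- 337000 + 3678900 * a - 7979785 * a ^ 2
      + 16362550 * a ^ 3 - 41145666 * a ^ 4 + 67430640 * a ^ 5 - 29395397 * a ^ 6
      - 873330 * a ^ 7 + 3684832 * a ^ 8 - 981760 * a ^ 9 + 86016 * a ^ 10)
      * / (50625 * (1 + a) ^ 3)) by (unfold P, Q, e; field; lra).
    apply Rmult_lt_0_compat; [apply Rmult_lt_0_compat |]; [lra | |].
    - apply large_exponent_polynomial_gt0; lra.
    - apply Rinv_0_lt_compat, Rmult_lt_0_compat; [lra | apply pow_lt; lra]. }
  apply Rle_lt_trans with (P * (2 / 5 * / (1 - e + e ^ 2 / 2 - e ^ 3 / 6))
    + Q * (1 + a * (2 * (5 - a) / 5 - 1))).
  { simpl; nra. }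
  apply Rmult_lt_reg_r with (1 - e + e ^ 2 / 2 - e ^ 3 / 6); trivial.
  replace ((P * (2 / 5 * / (1 - e + e ^ 2 / 2 - e ^ 3 / 6))
      + Q * (1 + a * (2 * (5 - a) / 5 - 1))) * (1 - e + e ^ 2 / 2 - e ^ 3 / 6))
    with (P * (2 / 5) + Q * (1 + a * (2 * (5 - a) / 5 - 1))
      * (1 - e + e ^ 2 / 2 - e ^ 3 / 6)) by (field; lra).
  lra.
Qed.

Lemma Cp2_lt_W p : 1 < p < 2 -> Cp2 p < W p.
Proof.
intros Hp.
assert (Ha : 0 < p - 1 < 1) by lra.
pose proof (Cp2_W_inequality (p - 1) Ha) as H.
unfold Cp2, W.
replace (5 - (p - 1)) with (6 - p) in H by ring.
rewrite !Rpower_div, <- !Rpower_mult_distr in H by lra.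
rewrite Rpower_opp_pred by lra.
replace (2 - p) with (1 + - (p - 1)) by ring.
rewrite Rpower_plus, Rpower_Ropp, Rpower_1 by lra.
pose proof (Rpower_gt0 2 (p - 1)) as H2; pose proof (Rpower_gt0 5 (p - 1)) as H5.
apply Rmult_lt_reg_r with (Rpower 2 (p - 1) * (40 * (6 - p))).
{ apply Rmult_lt_0_compat; lra. }
replace (2 * / Rpower 2 (p - 1) * (Rpower 2 (p - 1) * (40 * (6 - p))))
  with (80 * (6 - p)) by (field; lra).
eapply Rle_lt_trans; [| exact H].
apply Req_le; field; lra.
Qed.

(** * Behaviour at the endpoints of the exponent range *)

Lemma filterlim_squeeze (F : (R -> Prop) -> Prop) {FF : Filter F} (f g h : R -> R) l :
  F (fun x => f x <= g x <= h x) ->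
  filterlim f F (locally l) -> filterlim h F (locally l) ->
  filterlim g F (locally l).
Proof.
intros Hle Hf Hh; apply filterlim_locally; intros eps.
pose proof (proj1 (filterlim_locally f l) Hf eps) as H1.
pose proof (proj1 (filterlim_locally h l) Hh eps) as H2.
generalize (filter_and _ _ Hle (filter_and _ _ H1 H2)); apply filter_imp.
intros x [Hx [Hb1 Hb2]].
change (Rabs (f x - l) < eps) in Hb1; change (Rabs (h x - l) < eps) in Hb2.
change (Rabs (g x - l) < eps).
apply Rabs_def2 in Hb1; apply Rabs_def2 in Hb2; apply Rabs_def1; lra.
Qed.

Lemma right_lim_continuous F a : continuous F a -> right_lim F a (F a).
Proof. intros H; apply filterlim_filter_le_1 with (2 := H), filter_le_within. Qed.

Lemma left_lim_continuous F a : continuous F a -> left_lim F a (F a).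
Proof. intros H; apply filterlim_filter_le_1 with (2 := H), filter_le_within. Qed.

(** t ln t = - ln (1/t) / (1/t) tends to 0 with t. *)
Lemma right_lim_self_power : right_lim (fun p => Rpower (p - 1) (p - 1)) 1 1.
Proof.
assert (H1 : filterlim (fun p => / (p - 1)) (at_right 1) (Rbar_locally p_infty)).
{ apply (filterlim_comp _ _ _ (fun p => p - 1) Rinv _ (at_right 0));
    [| exact filterlim_Rinv_0_right].
  intros P [d Hd]; exists d; intros p Hp Hp1.
  change (Rabs (p - 1) < d) in Hp.
  apply Hd; [| lra].
  change (Rabs (p - 1 - 0) < d); now rewrite Rminus_0_r. }
assert (H2 : filterlim (fun p => ln (/ (p - 1)) / / (p - 1)) (at_right 1) (locally 0)).
{ apply (filterlim_comp _ _ _ _ (fun y => ln y / y) _ _ _ H1).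
  exact is_lim_div_ln_p. }
assert (H3 : filterlim (fun p => exp (- (ln (/ (p - 1)) / / (p - 1))))
   (at_right 1) (locally 1)).
{ apply (filterlim_comp _ _ _ _ (fun y => exp (- y)) _ _ _ H2).
  replace 1 with (exp (- 0)) by (rewrite Ropp_0; apply exp_0).
  apply (ex_derive_continuous (fun y => exp (- y))); auto_derive; trivial. }
apply (filterlim_within_ext _ _ _) with (2 := H3).
intros p Hp; unfold Rpower; rewrite ln_Rinv by lra; f_equal; field; lra.
Qed.

Lemma right_lim_affine_self_power (u v : R -> R) :
  continuous u 1 -> continuous v 1 ->
  right_lim (fun p => u p * Rpower (p - 1) (p - 1) + v p) 1 (u 1 + v 1).
Proof.
intros Hu Hv.
apply right_lim_continuous in Hu; apply right_lim_continuous in Hv.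
replace (u 1 + v 1) with (u 1 * 1 + v 1) by ring.
refine (filterlim_comp_2 _ _ Rplus _ Hv
  (@filterlim_plus R_AbsRing R_NormedModule (u 1 * 1) (v 1))).
exact (filterlim_comp_2 _ _ Rmult Hu right_lim_self_power
  (@filterlim_mult R_AbsRing (u 1) 1)).
Qed.

Ltac continuity := apply @ex_derive_continuous; unfold Rpower; auto_derive; lra.

Lemma continuous_W p : continuous W p.
Proof. apply (ex_derive_continuous W); unfold W, Rpower; auto_derive; trivial. Qed.

Lemma W_1 : W 1 = 2.
Proof. unfold W; replace (2 - 1) with 1 by ring; apply Rpower_1; lra. Qed.

Lemma W_2 : W 2 = 1.
Proof. unfold W; replace (2 - 2) with 0 by ring; apply Rpower_O; lra. Qed.

Lemma right_lim_W : right_lim W 1 2.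
Proof.
replace 2 with (W 1) by exact W_1; apply right_lim_continuous, continuous_W.
Qed.

Lemma Rpower_opp_1 c : 0 < c -> Rpower c (-1) = / c.
Proof.
intros Hc; replace (-1) with (- (1)) by ring; now rewrite Rpower_Ropp, Rpower_1.
Qed.

Lemma Rpower_opp_2 c : 0 < c -> Rpower c (-2) = / (c * c).
Proof.
intros Hc; replace (-2) with (-1 + -1) by ring.
rewrite Rpower_plus, Rpower_opp_1 by trivial; field; lra.
Qed.

Lemma right_lim_Cm1 : right_lim Cm1 1 2.
Proof.
replace 2 with (Rpower 2 (- (1)) * (1 + 1) + Rpower 2 (- (1)) * Rpower (3 - 1) 1).
- apply (filterlim_ext (fun p => Rpower 2 (- p) * (p + 1) * Rpower (p - 1) (p - 1)
      + Rpower 2 (- p) * Rpower (3 - p) p)).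
  { intros p; unfold Cm1; ring. }
  apply (right_lim_affine_self_power (fun p => Rpower 2 (- p) * (p + 1))
     (fun p => Rpower 2 (- p) * Rpower (3 - p) p)); continuity.
- rewrite Rpower_opp_1, Rpower_1 by lra; field.
Qed.

Lemma right_lim_Cm2 : right_lim Cm2 1 2.
Proof.
replace 2 with (Rpower 5 (- (1)) * (4 * 1 + 1) + Rpower 5 (- (1)) * Rpower (6 - 1) 1).
- apply (filterlim_ext (fun p => Rpower 5 (- p) * (4 * p + 1) * Rpower (p - 1) (p - 1)
      + Rpower 5 (- p) * Rpower (6 - p) p)).
  { intros p; unfold Cm2; ring. }
  apply (right_lim_affine_self_power (fun p => Rpower 5 (- p) * (4 * p + 1))
     (fun p => Rpower 5 (- p) * Rpower (6 - p) p)); continuity.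
- rewrite Rpower_opp_1, Rpower_1 by lra; field.
Qed.

Lemma right_lim_Cp1 : right_lim Cp1 1 2.
Proof.
pose (u := fun p => Rpower 2 (- p) / (50 * (3 - p))
  * (150 + 181 * p - 152 * p ^ 2 + 21 * p ^ 3)).
pose (v := fun p => Rpower 2 (- p) / (50 * (3 - p))
  * (Rpower (3 - p) (p - 1) * (450 - 381 * p + 152 * p ^ 2 - 21 * p ^ 3))).
replace 2 with (u 1 + v 1).
- apply (filterlim_ext (fun p => u p * Rpower (p - 1) (p - 1) + v p)).
  { intros p; unfold Cp1, u, v; ring. }
  apply right_lim_affine_self_power; unfold u, v; continuity.
- unfold u, v; rewrite Rminus_diag, Rpower_O, Rpower_opp_1 by lra; field.
Qed.

Lemma right_lim_Cp2 : right_lim Cp2 1 2.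
Proof.
pose (u := fun p => Rpower 5 (- p) / (8 * (6 - p))
  * (4 * (12 - 35 * p + 94 * p ^ 2 - 21 * p ^ 3))).
pose (v := fun p => Rpower 5 (- p) / (8 * (6 - p))
  * (Rpower (6 - p) (p - 1) * (288 - 15 * p - 94 * p ^ 2 + 21 * p ^ 3))).
replace 2 with (u 1 + v 1).
- apply (filterlim_ext (fun p => u p * Rpower (p - 1) (p - 1) + v p)).
  { intros p; unfold Cp2, u, v; ring. }
  apply right_lim_affine_self_power; unfold u, v; continuity.
- unfold u, v; rewrite Rminus_diag, Rpower_O, Rpower_opp_1 by lra; field.
Qed.

Lemma Cm1_2 : Cm1 2 = 1.
Proof.
unfold Cm1; replace (3 - 2) with 1 by ring; replace (2 - 1) with 1 by ring.
rewrite Rpower_opp_2, Rpower_1 by lra.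
replace 2 with (INR 2) at 3 by (simpl; ring); rewrite Rpower_pow by lra; field.
Qed.

Lemma Cm2_2 : Cm2 2 = 1.
Proof.
unfold Cm2; replace (2 - 1) with 1 by ring.
rewrite Rpower_opp_2, Rpower_1 by lra.
replace (Rpower (6 - 2) 2) with 16; [field |].
replace 2 with (INR 2) at 2 by (simpl; ring); rewrite Rpower_pow by lra; ring.
Qed.

Lemma Cp1_2 : Cp1 2 = 1.
Proof.
unfold Cp1; replace (2 - 1) with 1 by ring.
rewrite Rpower_opp_2, !Rpower_1 by lra; field.
Qed.

Lemma Cp2_2 : Cp2 2 = 1.
Proof.
unfold Cp2; replace (2 - 1) with 1 by ring.
rewrite Rpower_opp_2, !Rpower_1 by lra; field.
Qed.

Lemma Ctilde_lt_W p : 1 < p < 2 -> Ctilde p < W p.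
Proof.
intros Hp; eapply Rlt_trans; [now apply Ctilde_lt_Cp2 | now apply Cp2_lt_W].
Qed.

Lemma right_lim_Ctilde : right_lim Ctilde 1 2.
Proof.
apply filterlim_squeeze with Cm1 W.
- apply within_filter, locally_filter.
- apply (locally_interval _ 1 m_infty 2); simpl; try lra; trivial.
  intros p _ Hp2 Hp1; pose proof (Cm1_lt_Ctilde p); pose proof (Ctilde_lt_W p); lra.
- exact right_lim_Cm1.
- exact right_lim_W.
Qed.

(** Below 2 this is the differentiability of argmax; at 2 the values are
    squeezed between Ctilde 2 = 1 and W. *)
Lemma continuous_on_Ctilde : continuous_on (fun p => 1 < p <= 2) Ctilde.
Proof.
intros p Hp; destruct (Rlt_le_dec p 2) as [H | H].
- apply (filterlim_filter_le_1 _ (filter_le_within (F := locally p) _)).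
  apply (continuous_ext_loc _ (fun p => (p - 1) * exp ((p - 2) * ln (argmax p)))).
  + apply (locally_interval _ p 1 2); simpl; try lra.
    intros q Hq1 Hq2; rewrite Ctilde_argmax; trivial; split; trivial.
  + apply @ex_derive_continuous; auto_derive; split; trivial.
    * eexists; apply is_derive_argmax; lra.
    * split; trivial; apply argmax_01; lra.
- replace p with 2 by lra; rewrite Ctilde_2.
  apply filterlim_squeeze with (fun _ => 1) W.
  + apply within_filter, locally_filter.
  + apply (filter_forall (F := locally 2)); intros q Hq; destruct (Rlt_le_dec q 2) as [H' | H'].
    * pose proof (Ctilde_lt_W q); pose proof (Ctilde_decreasing q 2).
      rewrite Ctilde_2 in *; lra.
    * replace q with 2 by lra; rewrite Ctilde_2, W_2; lra.
  + apply filterlim_const.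
  + apply (filterlim_filter_le_1 _ (filter_le_within (F := locally 2) _)).
    rewrite <- W_2; apply continuous_W.
Qed.

Lemma exact_at_endpoints_intro B : right_lim B 1 2 -> continuous B 2 -> B 2 = 1 ->
  exact_at_endpoints B.
Proof.
intros H1 Hc H2; split; [| repeat split].
- exists 2; split; [exact right_lim_Ctilde | exact H1].
- generalize (continuous_on_Ctilde 2 ltac:(lra)); apply filterlim_filter_le_1.
  intros P [d Hd]; exists (mkposreal _ (Rmin_pos _ _ (cond_pos d) Rlt_0_1)).
  intros p Hp Hp2; change (Rabs (p - 2) < Rmin d 1) in Hp.
  apply Hd.
  + change (Rabs (p - 2) < d); eapply Rlt_le_trans; [exact Hp | apply Rmin_l].
  + assert (Hp1 : Rabs (p - 2) < 1) by (eapply Rlt_le_trans; [exact Hp | apply Rmin_r]).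
    apply Rabs_def2 in Hp1; lra.
- rewrite Ctilde_2, <- H2; now apply left_lim_continuous.
- now rewrite Ctilde_2.
Qed.

Lemma exact_W : exact_at_endpoints W.
Proof. apply exact_at_endpoints_intro; [apply right_lim_W | apply continuous_W | apply W_2]. Qed.

Lemma exact_Cm1 : exact_at_endpoints Cm1.
Proof.
apply exact_at_endpoints_intro; [apply right_lim_Cm1 | unfold Cm1; continuity | apply Cm1_2].
Qed.

Lemma exact_Cm2 : exact_at_endpoints Cm2.
Proof.
apply exact_at_endpoints_intro; [apply right_lim_Cm2 | unfold Cm2; continuity | apply Cm2_2].
Qed.

Lemma exact_Cp1 : exact_at_endpoints Cp1.
Proof.
apply exact_at_endpoints_intro; [apply right_lim_Cp1 | unfold Cp1; continuity | apply Cp1_2].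
Qed.

Lemma exact_Cp2 : exact_at_endpoints Cp2.
Proof.
apply exact_at_endpoints_intro; [apply right_lim_Cp2 | unfold Cp2; continuity | apply Cp2_2].
Qed.

(** * Algebraic values *)

Module AlgebraicNumbers.
Import ssreflect ssrfun ssrbool eqtype ssrnat seq.
Import order ssralg ssrnum ssrint poly mxpoly rat Rstruct.
Import Order.TTheory GRing.Theory Num.Theory.
Local Open Scope ring_scope.

(** c is a root of the monic polynomial X^n - c^n, whose coefficients are
    integral over the rationals. *)
Lemma algebraic_pow_root (c : R) (n : nat) :
  n <> 0%N -> algebraic (pow c n) -> algebraic c.
Proof.
move=> /eqP n0; rewrite RpowE => /integral_algebraic int_cn.
apply/integral_algebraic.
apply: (@integral_root_monic _ _ _ c ('X^n - (c ^+ n)%:P)).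
- by rewrite monicXnsubC // lt0n.
- by rewrite rootE !hornerE subrr.
- apply/integral_poly => i; rewrite coefB coefXn coefC.
  apply: integral_sub; first exact: integral_nat.
  by case: eqP => _ //; exact: integral0.
Qed.

Lemma algebraic_rational (x : R) : rational x -> algebraic x.
Proof. by case=> q ->; exact: algebraic_id. Qed.

Lemma algebraic_pow (x : R) n : algebraic x -> algebraic (pow x n).
Proof.
move=> Hx; elim: n => [|n IHn]; first exact: algebraic1.
by rewrite /=; apply: algebraic_mul.
Qed.

Lemma algebraic_Rdiv (x y : R) : algebraic x -> algebraic y -> algebraic (Rdiv x y).
Proof. by move=> Hx Hy; rewrite RdivE; apply: algebraic_div. Qed.

(** The polynomial (a - X)^n - (1 - X)^m X^k is nonzero since its value at 0
    is a^n. *)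
Lemma algebraic_critical_root (a x : R) (n m k : nat) :
  rational a -> a <> IZR 0 -> k <> 0%N ->
  pow (Rminus a x) n = Rmult (pow (Rminus 1 x) m) (pow x k) -> algebraic x.
Proof.
case=> q -> q0 k0; rewrite !RpowE RmultE !RminusE => Hx.
exists ((q%:P - 'X) ^+ n - (1 - 'X) ^+ m * 'X^k).
- apply/eqP => /(congr1 (fun P => P.[0])) /eqP.
  rewrite !hornerE /= expr0n; case: k k0 {Hx} => [//|k] _ /=.
  rewrite mulr0 subr0 expf_eq0 => /andP[_ /eqP q00].
  by apply: q0; rewrite q00 rmorph0.
- rewrite rootE rmorphB rmorphM !rmorphXn /= !rmorphB /= map_polyC map_polyX rmorph1.
  by rewrite !hornerE /= Hx subrr.
Qed.

Lemma rational_fraction (a : R) : rational a -> Rlt (IZR 0) a ->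
  exists m n : nat, (n <> 0)%N /\ a = Rdiv (INR m) (INR n).
Proof.
case=> q -> /RltP; rewrite ltr0q => q_gt0.
exists `|numq q|%N, `|denq q|%N; split.
- by apply/eqP; rewrite absz_eq0 denq_neq0.
- rewrite !INRE RdivE -[LHS](congr1 (fun r => ratr r) (divq_num_den q)).
  rewrite /= fmorph_div !rmorph_int.
  rewrite !pmulrn !gez0_abs //.
  by rewrite numq_ge0 ltW.
Qed.

Lemma rational_pred (p : R) : rational p -> rational (Rminus p 1).
Proof. by case=> q ->; exists (q - 1); rewrite rmorphB rmorph1. Qed.

End AlgebraicNumbers.
Import AlgebraicNumbers.

Lemma Rpower_root_pow y a m n : 0 < y -> n <> O -> a = INR m / INR n ->
  Rpower y a ^ n = y ^ m.
Proof.
intros Hy Hn ->; apply not_0_INR in Hn.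
rewrite <- Rpower_pow by apply Rpower_gt0.
rewrite Rpower_mult; replace (INR m / INR n * INR n) with (INR m) by (field; trivial).
now apply Rpower_pow.
Qed.

(** With p - 1 = m / n and k = n - m, raising [argmax_eq] to the power n
    gives the equation of [algebraic_critical_root] for x = argmax p, and
    Ctilde p ^ n = (p - 1)^n / x^k. *)
Lemma Ctilde_algebraic p : 1 < p <= 2 -> rational p -> algebraic (Ctilde p).
Proof.
intros Hp Hr; destruct (Rlt_le_dec p 2) as [H2 | H2].
2:{ replace p with 2 by lra; rewrite Ctilde_2.
    exact (algebraic_pow p 0 (algebraic_rational p Hr)). }
assert (Hp' : 1 < p < 2) by lra.
assert (Hra : rational (p - 1)) by now apply rational_pred.
destruct (rational_fraction (p - 1) Hra ltac:(lra)) as [m [n [Hn Ha]]].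
assert (Hmn : (m < n)%nat).
{ apply INR_lt.
  assert (0 < INR n) by (apply lt_0_INR; lia).
  apply Rmult_lt_reg_r with (/ INR n); [now apply Rinv_0_lt_compat |].
  rewrite Rinv_r by lra; unfold Rdiv in Ha; lra. }
pose proof (argmax_01 p Hp') as Hx; pose proof (argmax_eq p Hp') as He.
set (x := argmax p) in *.
assert (Hk : Rpower x (p - 2) ^ n * x ^ (n - m) = 1).
{ replace (p - 2) with (p - 1 + -1) by ring.
  rewrite Rpower_plus, Rpow_mult_distr, (Rpower_root_pow x (p - 1) m n) by (trivial; lra).
  replace (-1) with (- (1)) by ring; rewrite Rpower_Ropp, Rpower_1 by lra.
  replace n with (m + (n - m))%nat at 1 by lia; rewrite pow_inv, pow_add.
  field; split; apply pow_nonzero; lra. }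
assert (Hxa : algebraic x).
{ apply (algebraic_critical_root (p - 1) x n m (n - m)); trivial; [lra | lia |].
  rewrite <- (Rpower_root_pow (1 - x) (p - 1) m n) by (trivial; lra).
  rewrite <- He, Rpow_mult_distr, Rmult_assoc, Hk; ring. }
apply (algebraic_pow_root _ n Hn).
replace (Ctilde p ^ n) with ((p - 1) ^ n / x ^ (n - m)).
- apply algebraic_Rdiv; apply algebraic_pow; trivial.
  now apply algebraic_rational.
- rewrite Ctilde_argmax by trivial; fold x; rewrite Rpow_mult_distr.
  assert (x ^ (n - m) <> 0) by (apply pow_nonzero; lra).
  apply Rmult_eq_reg_r with (x ^ (n - m)); trivial.
  rewrite Rmult_assoc, Hk; field; trivial.
Qed.

(** For p = 3/2 the equation squares to the quadratic
    (1/2 - x)^2 = x (1 - x). *)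
Lemma argmax_3_2 : argmax (3 / 2) = 1 / 4 * (2 - sqrt 2).
Proof.
assert (Hs : sqrt 2 * sqrt 2 = 2) by (apply sqrt_sqrt; lra).
assert (Hs0 : 0 <= sqrt 2) by apply sqrt_pos.
assert (Hs1 : 1 < sqrt 2 < 2) by nra.
apply (critical_unique (3 / 2)); [apply argmax_critical; lra | lra |].
set (x := 1 / 4 * (2 - sqrt 2)).
assert (Hx : 0 < x < 1 / 4) by (unfold x; lra).
rewrite slope_factor, Rpower_pred2 by lra.
replace (3 / 2 - 1) with (/ 2) by field; rewrite !Rpower_sqrt by lra.
assert (H1 : sqrt x * sqrt x = x) by (apply sqrt_sqrt; lra).
assert (H2 : 0 < sqrt x) by (apply sqrt_lt_R0; lra).
replace (sqrt (1 - x)) with ((/ 2 - x) / sqrt x).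
- replace (sqrt x / x) with (/ sqrt x); [field; lra |].
  rewrite <- H1 at 3; field; lra.
- symmetry; apply Rsqr_inj.
  + apply sqrt_pos.
  + apply Rlt_le, Rdiv_lt_0_compat; lra.
  + unfold Rsqr; rewrite sqrt_sqrt by lra.
    replace ((/ 2 - x) / sqrt x * ((/ 2 - x) / sqrt x)) with ((/ 2 - x) ^ 2 / x)
      by (rewrite <- H1 at 2; field; lra).
    apply Rmult_eq_reg_r with x; [| lra].
    replace ((/ 2 - x) ^ 2 / x * x) with ((/ 2 - x) ^ 2) by (field; lra).
    unfold x; nra.
Qed.

Lemma Ctilde_3_2 : Ctilde (3 / 2) = sqrt (1 + 1 / sqrt 2).
Proof.
rewrite Ctilde_argmax, argmax_3_2 by lra.
assert (Hs : sqrt 2 * sqrt 2 = 2) by (apply sqrt_sqrt; lra).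
assert (Hs0 : 0 <= sqrt 2) by apply sqrt_pos.
assert (Hs1 : 1 < sqrt 2 < 2) by nra.
replace (3 / 2 - 2) with (- / 2) by field.
rewrite Rpower_Ropp, Rpower_sqrt by lra.
set (x := 1 / 4 * (2 - sqrt 2)).
assert (Hx : 0 < x) by (unfold x; lra).
assert (H2 : 0 < sqrt x) by (apply sqrt_lt_R0; lra).
apply Rsqr_inj.
- apply Rmult_le_pos; [lra | apply Rlt_le, Rinv_0_lt_compat; lra].
- apply sqrt_pos.
- assert (0 < 1 / sqrt 2) by (apply Rdiv_lt_0_compat; lra).
  unfold Rsqr; rewrite (sqrt_sqrt (1 + _)) by lra.
  replace ((3 / 2 - 1) * / sqrt x * ((3 / 2 - 1) * / sqrt x))
    with (/ (4 * (sqrt x * sqrt x))) by (field; lra).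
  rewrite sqrt_sqrt by lra.
  apply Rmult_eq_reg_r with (sqrt 2 * (2 - sqrt 2)); [| nra].
  unfold x; field_simplify; nra.
Qed.

(** * The proposition *)

Theorem proposition1p8 :
  (forall p : R, 1 < p <= 2 -> is_finite (C_ (abs_pow p))) /\
  exists xp : R -> R,
  (* (i) *)
  (forall p : R, 1 < p < 2 ->
     unique (root_eq p) (xp p) /\
     Ctilde p = ell p (xp p) /\
     (forall x : R, 0 < x < 1 -> ell p x <= ell p (xp p)) /\
     (forall x y : R, 0 < x -> x < y -> y < xp p -> ell p x < ell p y) /\
     (forall x y : R, xp p < x -> x < y -> y < 1 -> ell p y < ell p x)) /\
  (* (ii) *)
  (forall p : R, 1 < p < 2 ->
     (p - 1) / 5 < xp p < (p - 1) / 2 /\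
     (forall x : R, (p - 1) / 5 < x < (p - 1) / 2 -> 0 < x < 1 / 2)) /\
  (* (iii) *)
  (continuous_on (fun p : R => 1 < p <= 2) Ctilde /\
   (forall p q : R, 1 < p -> p < q -> q <= 2 -> Ctilde q < Ctilde p) /\
   right_lim Ctilde 1 2 /\
   Ctilde 2 = 1 /\
   (forall p : R, 1 < p < 2 -> real_analytic_at Ctilde p)) /\
  (* (iv) *)
  ((forall p : R, 1 < p <= 2 -> rational p -> algebraic (Ctilde p)) /\
   Ctilde (3 / 2) = sqrt (1 + 1 / sqrt 2) /\
   xp (3 / 2) = 1 / 4 * (2 - sqrt 2)) /\
  (* (v) *)
  ((forall p : R, 1 < p < 2 ->
      Rmax (Cm1 p) (Cm2 p) < Ctilde p /\
      Ctilde p < Rmin (Cp1 p) (Cp2 p) /\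
      Rmin (Cp1 p) (Cp2 p) <= Cp2 p /\
      Cp2 p < W p) /\
   exact_at_endpoints W /\
   exact_at_endpoints Cm1 /\
   exact_at_endpoints Cm2 /\
   exact_at_endpoints Cp1 /\
   exact_at_endpoints Cp2).
Proof.
split.
{ intros p Hp; destruct (Rlt_le_dec p 2) as [H | H].
  - rewrite C_abs_pow_lt2; [reflexivity | lra].
  - replace p with 2 by lra; rewrite C_abs_pow_2; reflexivity. }
exists argmax; split; [| split; [| split; [| split]]].
- intros p Hp; split; [| split; [| split; [| split]]].
  + split.
    * apply root_eq_slope; split; [now apply argmax_01 | apply (argmax_critical p Hp)].
    * intros x Hx; apply root_eq_slope in Hx.
      apply (critical_unique p); [now apply argmax_critical | apply Hx | apply Hx].
  + now apply Ctilde_ell.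
  + intros x Hx; now apply ell_le_max.
  + intros x y Hx Hxy Hy; apply ell_increasing; lra.
  + intros x y Hx Hxy Hy; apply ell_decreasing; lra.
- intros p Hp; split; [now apply argmax_bounds | intros x Hx; lra].
- split; [exact continuous_on_Ctilde | split; [exact Ctilde_decreasing |]].
  split; [exact right_lim_Ctilde | split; [exact Ctilde_2 | exact Ctilde_analytic]].
- split; [exact Ctilde_algebraic | split; [exact Ctilde_3_2 | exact argmax_3_2]].
- split.
  + intros p Hp; split; [| split; [| split]].
    * apply Rmax_lub_lt; [now apply Cm1_lt_Ctilde | now apply Cm2_lt_Ctilde].
    * apply Rmin_glb_lt; [now apply Ctilde_lt_Cp1 | now apply Ctilde_lt_Cp2].
    * apply Rmin_r.
    * now apply Cp2_lt_W.
  + split; [exact exact_W | split; [exact exact_Cm1 | split; [exact exact_Cm2 |]]].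
    split; [exact exact_Cp1 | exact exact_Cp2].
Qed.
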